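(* Let $n\ge1$ and let $\{\mathbf{s}_1,\dots,\mathbf{s}_M\}\subset\mathbb{R}^n$ be any constellation of $M\ge2$ distinct points, used over the AWGN channel with maximum-likelihood detection. As a function of the noise power $P_N=\sigma_0^2>0$, the symbol error rate $P_e$ has the following properties: (1) $P_e$ is concave ($P_c$ is convex) on the range $P_N\ge\dfrac{d_{\max}^2}{n+2-\sqrt{2(n+2)}}$. (2) $P_e$ is convex ($P_c$ is concave) on the range $P_N\le\dfrac{d_{\min}^2}{n+2+\sqrt{2(n+2)}}$. (3) There is an odd number of inflection points of $P_e$ (equivalently of $P_c$) in the range $$\frac{d_{\min}^2}{n+2+\sqrt{2(n+2)}}\le P_N\le\frac{d_{\max}^2}{n+2-\sqrt{2(n+2)}} .$$
   Context: Setting: a constellation is a set of $M\ge2$ distinct points $\mathbf{s}_1,\dots,\mathbf{s}_M\in\mathbb{R}^n$, normalized by $\frac1M\sum_{i=1}^M|\mathbf{s}_i|^2=1$ ($|\cdot|$ is the Euclidean norm). The received vector is $\mathbf{r}=\mathbf{s}+\boldsymbol{\xi}$, where $\mathbf{s}$ is a random constellation point with prior probabilities $\Pr[\mathbf{s}=\mathbf{s}_i]\ge0$ summing to 1 (not depending on the noise), and $\boldsymbol\xi\sim\mathcal N(\mathbf 0,\sigma_0^2\mathbf I)$ is independent of $\mathbf{s}$. The maximum-likelihood detector outputs $\hat{\mathbf{s}}=\arg\min_{\mathbf{s}_i}|\mathbf{r}-\mathbf{s}_i|$. The noise power is $P_N=\sigma_0^2$. The decision region of $\mathbf{s}_i$,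 with the origin shifted to $\mathbf{s}_i$, is the convex polyhedron $\Omega_i=\{\mathbf{x}\in\mathbb{R}^n:\ \mathbf{a}_j^T\mathbf{x}\le b_j\ \ \forall j\ne i\}$ with $\mathbf{a}_j=(\mathbf{s}_j-\mathbf{s}_i)/|\mathbf{s}_j-\mathbf{s}_i|$, $b_j=\frac12|\mathbf{s}_j-\mathbf{s}_i|$. $P_{ci}(P_N)=\int_{\Omega_i}(2\pi P_N)^{-n/2}e^{-|\mathbf{x}|^2/(2P_N)}\,d\mathbf{x}$, $P_{ei}=1-P_{ci}$, $P_e=\sum_{i=1}^MP_{ei}\Pr[\mathbf{s}=\mathbf{s}_i]$, $P_c=1-P_e$. $d_{\min,i}=\min_{j\ne i} b_j$ and $d_{\max,i}$ are the minimum and maximum distances from the origin to the boundary of $\Omega_i$ ($d_{\max,i}=\infty$ if $\Omega_i$ is unbounded); $d_{\min}=\min_id_{\min,i}$, $d_{\max}=\max_id_{\max,i}$. If $d_{\max}=\infty$ the range in (1) is empty and the range in (3) is unbounded above. An inflection point is a zero of the second derivative in $P_N$ at which it changes sign. *)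

(* Defs.v *)
From HB Require Import structures.
From mathcomp Require Import all_boot all_order all_algebra.
From mathcomp Require Import all_classical all_reals all_analysis.

Set Implicit Arguments.
Unset Strict Implicit.
Unset Printing Implicit Defensive.

Import Order.TTheory GRing.Theory Num.Theory.
Import numFieldNormedType.Exports.

Local Open Scope classical_set_scope.
Local Open Scope ring_scope.

(* The sigma-algebra on R^n is generated by the coordinate functions; this is
   the Borel sigma-algebra. *)
Definition rV_display : measure_display.
Proof. exact: default_measure_display. Qed.

Section measurable_rV.
Context {R : realType} {n : nat}.

Let coord : 'I_n -> 'rV[R]_n -> measurableTypeR R := fun i v => v ord0 i.

Let rV_set0 : g_sigma_preimage coord set0.
Proof. exact: sigma_algebra0. Qed.

Let rV_setC A : g_sigma_preimage coord A -> g_sigma_preimage coord (~` A).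
Proof. exact: sigma_algebraC. Qed.

Let rV_bigcup (F : (set 'rV[R]_n)^nat) :
  (forall i, g_sigma_preimage coord (F i)) ->
  g_sigma_preimage coord (\bigcup_i F i).
Proof. exact: sigma_algebra_bigcup. Qed.

HB.instance Definition _ := @isMeasurable.Build rV_display
  'rV[R]_n (g_sigma_preimage coord) rV_set0 rV_setC rV_bigcup.

Lemma measurable_coord (i : 'I_n) :
  measurable_fun [set: 'rV[R]_n] (fun v => v ord0 i : measurableTypeR R).
Proof.
move=> _ Y mY; rewrite setTI; apply: sub_sigma_algebra => /=.
rewrite -bigcup_seq/=; exists i => /=; first by rewrite mem_index_enum.
by exists Y => //; rewrite setTI.
Qed.

Lemma measurable_rVP d (T : measurableType d) (f : T -> 'rV[R]_n) :
  (forall i, measurable_fun [set: T]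
    (fun x => f x ord0 i : measurableTypeR R)) ->
  measurable_fun [set: T] f.
Proof.
move=> mf.
have sub : g_sigma_preimage (fun i => coord i \o f) `<=` measurable.
  apply: smallest_sub; first exact: sigma_algebra_measurable.
  move=> B; rewrite -bigcup_seq /= => -[i _ [Y mY <-]].
  exact: (mf i).
move=> _ A mA; apply: sub.
by rewrite g_sigma_preimage_comp; exists A.
Qed.

End measurable_rV.

Section rV_cons.
Context {R : realType} {n : nat}.

Definition rV_cons (p : measurableTypeR R * 'rV[R]_n) : 'rV[R]_n.+1 :=
  \row_i if unlift ord0 i is Some j then p.2 ord0 j else p.1.

Definition rV_uncons (v : 'rV[R]_n.+1) : measurableTypeR R * 'rV[R]_n :=
  (v ord0 ord0, \row_j v ord0 (lift ord0 j)).

Lemma rV_cons0 p : rV_cons p ord0 ord0 = p.1.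
Proof. by rewrite mxE unlift_none. Qed.

Lemma rV_consS p j : rV_cons p ord0 (lift ord0 j) = p.2 ord0 j.
Proof. by rewrite mxE liftK. Qed.

Lemma rV_consK : cancel rV_cons rV_uncons.
Proof.
move=> p; rewrite /rV_uncons rV_cons0 [RHS]surjective_pairing; congr pair.
by apply/rowP => j; rewrite mxE rV_consS.
Qed.

Lemma measurable_rV_cons : measurable_fun setT rV_cons.
Proof.
apply: measurable_rVP => i; case: (unliftP ord0 i) => [j ->|->].
- under eq_fun do rewrite rV_consS.
  exact: (measurableT_comp (measurable_coord j) measurable_snd).
- under eq_fun do rewrite rV_cons0.
  exact: measurable_fst.
Qed.

Lemma measurable_rV_uncons : measurable_fun setT rV_uncons.
Proof.
apply: measurable_fun_pair; first exact: measurable_coord.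
apply: measurable_rVP => i.
under eq_fun do rewrite mxE.
exact: measurable_coord.
Qed.

End rV_cons.

(* Lebesgue measure on R^(n+1) as the image of the product of the Lebesgue
   measures on R and on R^n. *)
Section lebesgue_rVS.
Context {R : realType} {n : nat}.
Variable mu : {sigma_finite_measure set 'rV[R]_n -> \bar R}.

Definition lebesgue_rVS : set 'rV[R]_n.+1 -> \bar R :=
  pushforward (lebesgue_measure \x mu)%E rV_cons.

Let lebesgue_rVS0 : lebesgue_rVS set0 = 0%E.
Proof. have mf := @measurable_rV_cons R n; exact: measure0. Qed.

Let lebesgue_rVS_ge0 A : (0 <= lebesgue_rVS A)%E.
Proof. have mf := @measurable_rV_cons R n; exact: measure_ge0. Qed.

Let lebesgue_rVS_sigma_additive : semi_sigma_additive lebesgue_rVS.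
Proof.
have mf := @measurable_rV_cons R n; exact: measure_semi_sigma_additive.
Qed.

HB.instance Definition _ := isMeasure.Build _ _ _ lebesgue_rVS
  lebesgue_rVS0 lebesgue_rVS_ge0 lebesgue_rVS_sigma_additive.

Let lebesgue_rVS_sigma_finite : sigma_finite setT lebesgue_rVS.
Proof.
have /sigma_finiteP[F [TF ndF Foo]] :=
  sigma_finiteT (@lebesgue_measure R : {sigma_finite_measure set _ -> \bar R}).
have /sigma_finiteP[G [TG ndG Goo]] := sigma_finiteT mu.
exists (fun k => rV_uncons @^-1` (F k `*` G k)).
  rewrite -preimage_bigcup (_ : \bigcup_k _ = setT) ?preimage_setT//.
  rewrite -subTset => -[x y] _.
  have [k _ Fkx] : (\bigcup_k F k) x by rewrite -TF.
  have [l _ Gly] : (\bigcup_k G k) y by rewrite -TG.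
  exists (maxn k l) => //; split.
  - by move: x Fkx; exact/subsetPset/ndF/leq_maxl.
  - by move: y Gly; exact/subsetPset/ndG/leq_maxr.
move=> k; have [mF Fk] := Foo k; have [mG Gk] := Goo k; split.
  rewrite -[X in measurable X]setTI; apply: measurable_rV_uncons => //.
  exact: measurableX.
rewrite /lebesgue_rVS /pushforward -comp_preimage.
rewrite (_ : rV_uncons \o rV_cons = id); last exact/funext/rV_consK.
by rewrite product_measure1E// lte_mul_pinfty// ge0_fin_numE.
Qed.

HB.instance Definition _ := Measure_isSigmaFinite.Build _ _ _ lebesgue_rVS
  lebesgue_rVS_sigma_finite.

End lebesgue_rVS.

Fixpoint lebesgue_rV {R : realType} (n : nat) :
    {sigma_finite_measure set 'rV[R]_n -> \bar R} :=
  match n with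
  | 0 => dirac (0 : 'rV[R]_0)
  | m.+1 => lebesgue_rVS (lebesgue_rV m)
  end.

(* The volumes of boxes determine lebesgue_rV. *)
Lemma lebesgue_rV_box {R : realType} n (a b : 'I_n -> R) : (forall i, a i <= b i) ->
  lebesgue_rV n [set v | forall i, v ord0 i \in `[a i, b i]] =
  (\prod_i (b i - a i))%:E.
Proof.
elim: n a b => [|n IH] a b ab.
  by rewrite big_ord0 /= /dirac indicE mem_set// => -[].
rewrite /= /lebesgue_rVS /pushforward.
have -> : rV_cons @^-1`
    [set v : 'rV[R]_n.+1 | forall i, v ord0 i \in `[a i, b i]] =
  ([set` `[a ord0, b ord0]] : set (measurableTypeR R)) `*`
    [set v : 'rV[R]_n | forall i : 'I_n,
      v ord0 i \in `[a (lift ord0 i), b (lift ord0 i)]].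
  apply/seteqP; split => [p /= h|p /= [h1 h2] i].
    split; first by have := h ord0; rewrite rV_cons0.
    by move=> i; have := h (lift ord0 i); rewrite rV_consS.
  by case: (unliftP ord0 i) => [j ->|->]; rewrite ?rV_cons0 ?rV_consS//;
    exact: h2.
rewrite product_measure1E//; last first.
  rewrite (_ : [set _ | _] = \bigcap_(i in [set: 'I_n])
      ((fun v : 'rV[R]_n => v ord0 i : measurableTypeR R) @^-1`
        [set` `[a (lift ord0 i), b (lift ord0 i)]])).
    apply: fin_bigcap_measurable => // i _.
    by rewrite -[X in measurable X]setTI; exact: measurable_coord.
  by apply/seteqP; split => [v h i _|v h i]; [exact: h|exact: (h i I)].
rewrite IH; last by move=> i; exact: ab.
rewrite /= big_ord_recl EFinM; congr (_ * _)%E.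
have := @lebesgue_measure_itv R `[a ord0, b ord0] => /= ->.
by rewrite lte_fin; case: ltgtP (ab ord0) => //= -> _; rewrite subrr.
Qed.

Section euclidean.
Context {R : realType} {n : nat}.
Implicit Types u v : 'rV[R]_n.

Definition dotv u v : R := (u *m v^T) ord0 ord0.

(* The norm of the library on 'rV[R]_n is the sup norm. *)
Definition enorm u : R := Num.sqrt (dotv u u).

End euclidean.

Definition boundary {T : topologicalType} (A : set T) : set T :=
  closure A `\` interior A.

(* Density at x of the centered Gaussian vector with covariance P *: 1%:M. *)
Definition gauss_density {R : realType} {n : nat} (P : R) (x : 'rV[R]_n) : R :=
  (2 * pi * P) `^ (- (n%:R / 2)) * expR (- (enorm x ^+ 2 / (2 * P))).

Section constellation.
Context {R : realType} {n M : nat}.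
Variables (s : 'I_M -> 'rV[R]_n) (prior : 'I_M -> R).

Definition normalized : Prop := M%:R^-1 * \sum_i enorm (s i) ^+ 2 = 1.

Definition is_prior : Prop :=
  (forall i, 0 <= prior i) /\ \sum_i prior i = 1.

Definition unit_dir (i j : 'I_M) : 'rV[R]_n :=
  (enorm (s j - s i))^-1 *: (s j - s i).

Definition half_dist (i j : 'I_M) : R := enorm (s j - s i) / 2.

Definition decision_region (i : 'I_M) : set 'rV[R]_n :=
  [set x | forall j, j != i -> dotv (unit_dir i j) x <= half_dist i j].

Definition Pc_at (i : 'I_M) (P : R) : R :=
  (\int[lebesgue_rV n]_(x in decision_region i) gauss_density P x)%R.

Definition Pe_at (i : 'I_M) (P : R) : R := 1 - Pc_at i P.

Definition Pe (P : R) : R := \sum_i Pe_at i P * prior i.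

Definition Pc (P : R) : R := 1 - Pe P.

(* With at least two points the families below are nonempty, so that the
   neutral elements +oo and -oo play no role. *)
Definition dmin_at (i : 'I_M) : \bar R :=
  \big[Order.min/+oo%E]_(j < M | j != i) (half_dist i j)%:E.

Definition dmin : \bar R := \big[Order.min/+oo%E]_(i < M) dmin_at i.

Definition dmax_at (i : 'I_M) : \bar R :=
  if `[< bounded_set (decision_region i) >] then
    ereal_sup [set (enorm x)%:E | x in boundary (decision_region i)]
  else +oo%E.

Definition dmax : \bar R := \big[Order.max/-oo%E]_(i < M) dmax_at i.

Definition low_noise_bound : \bar R :=
  (dmin ^+ 2 * ((n%:R + 2 + Num.sqrt (2 * (n%:R + 2)))^-1)%:E)%E.

Definition high_noise_bound : \bar R :=
  (dmax ^+ 2 * ((n%:R + 2 - Num.sqrt (2 * (n%:R + 2)))^-1)%:E)%E.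

End constellation.

Section real_functions.
Context {R : realType}.
Implicit Types (D : set R) (f g : R -> R) (x : R).

Definition convex_on D f : Prop := @convex_function R R^o D f.

Definition concave_on D f : Prop := convex_on D (fun x => - f x).

Definition changes_sign_at g x : Prop :=
  ((\forall y \near x^'-, g y < 0) /\ (\forall y \near x^'+, 0 < g y)) \/
  ((\forall y \near x^'-, 0 < g y) /\ (\forall y \near x^'+, g y < 0)).

(* Twice differentiability is required because derive1 is a total function. *)
Definition inflection_point f x : Prop :=
  [/\ \forall y \near x, derivable f y 1 /\ derivable (derive1 f) y 1,
      derive1n 2 f x = 0
    & changes_sign_at (derive1n 2 f) x].

Definition odd_cardinal D : Prop := exists2 k, odd k & (D #= `I_k)%card.

End real_functions.

(* Main.v *)
(* Below the low noise threshold the Gaussian density is, at each point outside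
   a decision region, a convex function of the noise power; above the high
   threshold it is so at each point inside.  Integrating over the complement of
   the region, resp. over the region, gives (2), resp. (1).

   For (3), let x = P^(-1/2).  By rescaling, Pc_at is the standard Gaussian
   measure of x Omega.  The indicator of the polyhedron Omega is a signed sum of
   indicators of translated cones w + C, and x (w + C) = x w + C, of standard
   Gaussian measure exp (- x^2 |w|^2 / 2) times a Laplace transform of C at x w.
   Hence Pe is, as a function f of x > 0, the restriction of a function analytic
   on the whole real line, including at x = 0 (that is, at P = +oo).  The second
   derivative of Pe in P is x^5 / 4 times k (x) = 3 f' (x) + x f'' (x), and k is
   analytic, so it has a definite sign on each side of every point, negative
   near 0 because f is nonincreasing, and positive for large x by (2).  Hence k
   changes sign an odd number of times, and never where Pe is convex or concave
   by (1) and (2). *)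

Require Import Defs.
From mathcomp Require Import all_boot all_order all_algebra.
From mathcomp Require Import all_classical all_reals all_analysis.
From mathcomp Require Import measurable_realfun.
From mathcomp Require Import ring lra.

Set Implicit Arguments.
Unset Strict Implicit.
Unset Printing Implicit Defensive.

Import Order.TTheory GRing.Theory Num.Theory.
Import numFieldNormedType.Exports.

Local Open Scope classical_set_scope.
Local Open Scope ring_scope.

(** * Mean value arguments and sign changes *)

(** The delicate end is P = +oo. When some region is unbounded, the range in (3) has no upper bound,
    and analyticity in P > 0 alone would not keep inflection points from accumulating at infinity.
    In x = P^(-1/2) that end is the point 0, and analyticity there leaves finitely many sign changes
    on a compact interval. For a bounded Omega one could expand the Gaussian under the integral, but
    over an unbounded Omega the integral of exp (- x^2 |y|^2 / 2) diverges at x = 0; a cone avoids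
    this, because dilation moves only its apex. Analyticity is used in a single form: the whole
    sequence of derivatives, with Cauchy estimates C K^k k! on every bounded set. This gives the
    identity theorem, hence one-sided signs at every point for a function that is not identically
    zero; that Pe is not constant is therefore a separate fact to prove. Parts (1) and (2) need no
    differentiation under the integral sign, since pointwise convexity of the density is integrated
    directly. They enter (3) only through a midpoint inequality. *)

Section real_calculus.
Context {R : realType}.
Implicit Types (f : R -> R) (a b x y : R).

Lemma is_derive_continuous f x d : is_derive x 1 f d -> {for x, continuous f}.
Proof.
by move=> fd; apply/differentiable_continuous/derivable1_diffP; exact: ex_derive.
Qed.

Lemma mean_value f df a b : a < b ->
  (forall x, a <= x <= b -> is_derive x 1 f (df x)) ->
  exists2 c, a < c < b & f b - f a = df c * (b - a).
Proof.
move=> ab fd; have [||c cab ->] := @MVT R f df a b ab.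
- by move=> x; rewrite in_itv/= => /andP[/ltW ax /ltW xb]; apply: fd; rewrite ax.
- apply: derivable_within_continuous => x; rewrite in_itv/= => xab.
  by have := fd _ xab => ?; exact: ex_derive.
- by exists c => //; move: cab; rewrite in_itv.
Qed.

Lemma derive_ge0_le f df a b : a <= b ->
  (forall x, a <= x <= b -> is_derive x 1 f (df x)) ->
  (forall x, a <= x <= b -> 0 <= df x) -> f a <= f b.
Proof.
rewrite le_eqVlt => /predU1P[->//|ab] fd df0.
have [c /andP[ac cb] e] := mean_value ab fd.
rewrite -subr_ge0 e mulr_ge0 ?df0 ?(ltW ac) ?(ltW cb)//.
by rewrite subr_ge0 ltW.
Qed.

Lemma derive2_ge0_convex f f1 f2 a b t : a < b -> 0 < t < 1 ->
  (forall x, a <= x <= b -> is_derive x 1 f (f1 x)) ->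
  (forall x, a <= x <= b -> is_derive x 1 f1 (f2 x)) ->
  (forall x, a <= x <= b -> 0 <= f2 x) ->
  f (t * a + (1 - t) * b) <= t * f a + (1 - t) * f b.
Proof.
move=> ab /andP[t0 t1] fd f1d f20; set z := t * a + (1 - t) * b.
have az : a < z by rewrite /z; nra.
have zb : z < b by rewrite /z; nra.
have sub c d x : a <= c -> d <= b -> c <= x <= d -> a <= x <= b.
  by move=> ac db /andP[cx xd]; rewrite (le_trans ac cx) (le_trans xd db).
have [c1 /andP[ac1 c1z] e1] : exists2 c, a < c < z & f z - f a = f1 c * (z - a).
  by apply: mean_value => // x h; apply: fd; apply: sub h; rewrite // ltW.
have [c2 /andP[zc2 c2b] e2] : exists2 c, z < c < b & f b - f z = f1 c * (b - z).
  by apply: mean_value => // x h; apply: fd; apply: sub h; rewrite // ltW.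
have c12 : f1 c1 <= f1 c2.
  have c1c2 : c1 <= c2 by rewrite (le_trans (ltW c1z) (ltW zc2)).
  apply: (derive_ge0_le c1c2) => x h; [apply: f1d|apply: f20];
    by apply: sub h; rewrite ltW.
have e1' : z - a = (1 - t) * (b - a) by rewrite /z; ring.
have e2' : b - z = t * (b - a) by rewrite /z; ring.
have -> : t * f a + (1 - t) * f b = f z + t * (1 - t) * (b - a) * (f1 c2 - f1 c1).
  have -> : t * f a + (1 - t) * f b =
    f z - t * (f z - f a) + (1 - t) * (f b - f z) by ring.
  by rewrite e1 e2 e1' e2'; ring.
rewrite lerDl; apply: mulr_ge0; last by rewrite subr_ge0.
apply: mulr_ge0; last by rewrite subr_ge0 ltW.
by apply: mulr_ge0; [exact: ltW|rewrite subr_ge0 ltW].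
Qed.

(** The sign is assumed on the open interval only, as one-sided sign information says nothing at the
    endpoints. The conclusion is what contradicts convexity at weight 1/2. *)
Lemma derive2_lt0_midpoint f f1 f2 a b : a < b ->
  (forall x, a <= x <= b -> is_derive x 1 f (f1 x)) ->
  (forall x, a <= x <= b -> is_derive x 1 f1 (f2 x)) ->
  (forall x, a < x < b -> f2 x < 0) ->
  f a + f b < 2 * f ((a + b) / 2).
Proof.
move=> ab fd f1d f20; set z := (a + b) / 2.
have az : a < z by rewrite /z; lra.
have zb : z < b by rewrite /z; lra.
have sub c d x : a <= c -> d <= b -> c <= x <= d -> a <= x <= b.
  by move=> ac db /andP[cx xd]; rewrite (le_trans ac cx) (le_trans xd db).
have [c1 /andP[ac1 c1z] e1] : exists2 c, a < c < z & f z - f a = f1 c * (z - a).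
  by apply: mean_value => // x h; apply: fd; apply: sub h; rewrite // ltW.
have [c2 /andP[zc2 c2b] e2] : exists2 c, z < c < b & f b - f z = f1 c * (b - z).
  by apply: mean_value => // x h; apply: fd; apply: sub h; rewrite // ltW.
have c12 : c1 < c2 by exact: lt_trans zc2.
have [c /andP[c1c cc2] e] : exists2 c, c1 < c < c2 &
    f1 c2 - f1 c1 = f2 c * (c2 - c1).
  by apply: mean_value => // x h; apply: f1d; apply: sub h; rewrite // ltW.
have : f2 c < 0 by apply: f20; rewrite (lt_trans ac1 c1c) (lt_trans cc2 c2b).
have ez : b - z = z - a by rewrite /z; field.
rewrite ez in e2 => f2c; rewrite -subr_gt0.
have -> : 2 * f z - (f a + f b) = - (f2 c) * ((c2 - c1) * (z - a)).
  have -> : 2 * f z - (f a + f b) = (f z - f a) - (f b - f z) by ring.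
  by rewrite e1 e2 -mulrBl -opprB e; ring.
by rewrite mulr_gt0 ?oppr_gt0// mulr_gt0// subr_gt0.
Qed.

End real_calculus.

(* As in (-1) ^+ b, the boolean true encodes the negative sign. *)
Section sign_changes.
Context {R : realType}.
Variable k : R -> R.
Implicit Types (b : bool) (x y : R).

Definition signed (b : bool) (v : R) : Prop := 0 < (-1) ^+ b * v.

Definition right_sign x b := exists2 d, 0 < d &
  forall y, x < y < x + d -> signed b (k y).

Definition left_sign x b := exists2 d, 0 < d &
  forall y, x - d < y < x -> signed b (k y).

Definition sign_change x := exists2 b, left_sign x b & right_sign x (~~ b).

Lemma signed_inj b c v : signed b v -> signed c v -> b = c.
Proof.
rewrite /signed; case: b; case: c => //; rewrite expr0 expr1 ?mul1r ?mulN1r.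
- by rewrite oppr_gt0 => /lt_trans h /h; rewrite ltxx.
- by rewrite oppr_gt0 => h /(lt_trans h); rewrite ltxx.
Qed.

Lemma right_sign_inj x b c : right_sign x b -> right_sign x c -> b = c.
Proof.
move=> [d d0 h] [e e0 g]; pose m := Num.min d e.
have m0 : 0 < m by rewrite lt_min d0.
have hm : x < x + m / 2 by lra.
have [md me] : m <= d /\ m <= e by rewrite !ge_min !lexx orbT.
by apply: (@signed_inj b c (k (x + m / 2))); [apply: h|apply: g];
  apply/andP; split => //; lra.
Qed.

Lemma left_sign_inj x b c : left_sign x b -> left_sign x c -> b = c.
Proof.
move=> [d d0 h] [e e0 g]; pose m := Num.min d e.
have m0 : 0 < m by rewrite lt_min d0.
have [md me] : m <= d /\ m <= e by rewrite !ge_min !lexx orbT.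
by apply: (@signed_inj b c (k (x - m / 2))); [apply: h|apply: g];
  apply/andP; split; lra.
Qed.

Section interval.
Variables (x y : R) (c : bool).
Hypothesis kc : forall z, x < z < y -> signed c (k z).

Lemma itv_right_sign z : x <= z < y -> right_sign z c.
Proof.
move=> /andP[xz zy]; exists (y - z); first by rewrite subr_gt0.
move=> t /andP[zt ty]; apply: kc; rewrite (le_lt_trans xz zt)/=.
by move: ty; rewrite addrCA subrr addr0.
Qed.

Lemma itv_left_sign z : x < z <= y -> left_sign z c.
Proof.
move=> /andP[xz zy]; exists (z - x); first by rewrite subr_gt0.
move=> t /andP[zt ty]; apply: kc; rewrite (lt_le_trans ty zy) andbT.
by move: zt; rewrite opprB addrCA subrr addr0.
Qed.

Lemma itv_sign_change z : x < z < y -> ~ sign_change z.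
Proof.
move=> /andP[xz zy] [b lb rb].
have eb : b = c.
  by apply: (left_sign_inj lb); apply: itv_left_sign; rewrite xz ltW.
have : ~~ b = c.
  by apply: (right_sign_inj rb); apply: itv_right_sign; rewrite (ltW xz).
by rewrite eb; case: (c).
Qed.

End interval.

Hypothesis kR : forall x, 0 <= x -> exists b, right_sign x b.
Hypothesis kL : forall x, 0 < x -> exists b, left_sign x b.
Variable b0 : bool.
Hypothesis k0 : right_sign 0 b0.

(** The invariant of the continuous induction. The point x itself is left out, so that whether it is
    a sign change can be decided once the sign to its right is known. *)
Definition parity x := forall b, left_sign x b ->
  exists s : seq R, [/\ uniq s,
    forall z, (z \in s) <-> (0 < z < x /\ sign_change z) & odd (size s) = b0 (+) b].

(** The only possible new sign change is x, and it is one exactly when the sign [bl] to its left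
    differs from c. Then both the parity of the count and the sign on the left of the current point
    flip. *)
Lemma parity_step x y c : 0 < x -> x < y ->
  (forall z, x < z < y -> signed c (k z)) -> parity x -> parity y.
Proof.
move=> x0 xy kc px b lb.
have rx : right_sign x c by apply: (itv_right_sign kc); rewrite lexx.
have {lb}-> : b = c.
  by apply: (left_sign_inj lb); apply: (itv_left_sign kc); rewrite xy lexx.
have [bl lx] := kL x0; have [s [us ms os]] := px _ lx.
have split_itv z : 0 < z < y -> [\/ 0 < z < x, z = x | x < z < y].
  move=> /andP[z0 zy]; case: (ltgtP z x) => zx.
  - by apply: Or31; rewrite z0.
  - by apply: Or33; rewrite zy.
  - exact: Or32.
have [ebc|nbc] := eqVneq bl c.
  exists s; split => //; last by rewrite os ebc.
  move=> z; split=> [/ms[/andP[z0 zx] zs]|[zy zs]].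
    by rewrite z0 (lt_trans zx xy).
  apply/ms; split=> //; case: (split_itv _ zy) => // [ezx|zxy].
  + move: zs; rewrite ezx => -[b' lb' rb'].
    move: (left_sign_inj lb' lx) (right_sign_inj rb' rx) => -> /eqP.
    by rewrite ebc; case: (c).
  + by have := itv_sign_change kc zxy.
exists (x :: s); split.
- rewrite /= us andbT; apply/negP => /ms[]; by rewrite ltxx andbF.
- move=> z; rewrite inE; split=> [/predU1P[->|/ms[/andP[z0 zx] zs]]|[zy zs]].
  + split; first by rewrite x0.
    by exists bl => //; move: nbc rx; case: (bl); case: (c).
  + by rewrite z0 (lt_trans zx xy).
  + apply/orP; case: (split_itv _ zy) => [zx|->|zxy]; first by right; apply/ms.
      by left.
    by have := itv_sign_change kc zxy.
- by rewrite /= os; move: nbc; case: (bl); case: (c); case: (b0).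
Qed.

(* Continuous induction on E. *)
Lemma parity_gt0 E : 0 < E -> parity E.
Proof.
move=> E0; pose T := [set x | 0 < x <= E /\ forall y, 0 < y <= x -> parity y].
have [d d0 kd] := k0; rewrite add0r in kd.
have small y : 0 < y < d -> parity y.
  move=> /andP[y0 yd] b lb; exists [::]; split => //.
  - move=> z; split => // -[/andP[z0 zy] zs].
    by have := @itv_sign_change 0 d b0 kd z; rewrite z0 (lt_trans zy yd) => /(_ isT).
  - rewrite (@left_sign_inj y b b0)//; first by case: (b0).
    by apply: (@itv_left_sign 0 d b0 kd); rewrite y0 ltW.
have T0 : T (Num.min E (d / 2)).
  have m0 : 0 < Num.min E (d / 2) by rewrite lt_min E0 divr_gt0.
  split; first by rewrite m0 ge_min lexx.
  move=> y /andP[y0]; rewrite le_min => /andP[yE yd]; apply: small.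
  by rewrite y0/=; lra.
have hT : has_sup T.
  by split; [exists (Num.min E (d / 2))|exists E => x [/andP[]]].
set u := sup T.
have Tle x : T x -> x <= u by move=> Tx; apply: sup_upper_bound.
have u0 : 0 < u by apply: lt_le_trans (Tle _ T0); rewrite lt_min E0 divr_gt0.
have uE : u <= E by apply: sup_le_ub => [|x [/andP[]]//]; exists (Num.min E (d/2)).
have Pu : forall y, 0 < y <= u -> parity y.
  have Plt y : 0 < y < u -> parity y.
    move=> /andP[y0 yu].
    have [t [_ Tt] yt] : exists2 t, T t & y < t.
      have yu0 : 0 < u - y by rewrite subr_gt0.
      by have [t Tt yt] := sup_adherent yu0 hT; exists t => //;
        move: yt; rewrite subKr.
    by apply: Tt; rewrite y0 ltW.
  move=> y /andP[y0]; rewrite le_eqVlt => /predU1P[->|yu]; last exact/Plt/andP.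
  (* The left sign at u gives an interval ]t, u[ of constant sign, across which the invariant passes
     from t < u to u. The right sign at u later pushes it beyond u, contradicting the supremum. *)
  have [c [e e0 ke]] := kL u0.
  pose t := Num.max (u / 2) (u - e / 2).
  have t0 : 0 < t by rewrite lt_max divr_gt0.
  have tu : t < u by rewrite gt_max; apply/andP; split; lra.
  apply: (@parity_step t u c) => //; last by apply: Plt; rewrite t0.
  move=> z /andP[tz zu]; apply: ke; rewrite zu andbT.
  have : u - e / 2 <= t by rewrite le_max lexx orbT.
  by move=> h; lra.
move: uE; rewrite le_eqVlt => /predU1P[<-|uE]; first by apply: Pu; rewrite u0 lexx.
have [c [e e0 ke]] := kR (ltW u0).
pose v := Num.min E (u + e / 2).
have uv : u < v by rewrite lt_min uE/= ltrDl divr_gt0.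
suff Tv : T v by have := Tle _ Tv; rewrite leNgt uv.
split; first by rewrite (lt_trans u0 uv) ge_min lexx.
move=> y /andP[y0 yv].
have [yu|uy] := leP y u; first by apply: Pu; rewrite y0.
apply: (@parity_step u y c) => //; last by apply: Pu; rewrite u0 lexx.
move=> z /andP[uz zy]; apply: ke; rewrite uz/=.
have : v <= u + e / 2 by rewrite ge_min lexx orbT.
by move=> h; lra.
Qed.

End sign_changes.

(** * Analytic functions on the real line *)

Section entire_functions.
Context {R : realType}.
Implicit Types (F G : nat -> R -> R) (f g : R -> R) (x y a h M B C K : R).

(** Carrying all derivatives as one sequence avoids iterating [derive1]. With [factorial_bound],
    whose constants depend on B, this is real analyticity on the whole line: Taylor series have
    radius of convergence at least 1/K at the interior points of [-B, B], but need not converge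
    everywhere. *)
Definition deriv_seq F := forall k x, is_derive x 1 (F k) (F k.+1 x).

Definition factorial_bound F := forall B, exists C K,
  [/\ 0 <= C, 0 <= K & forall k x, `|x| <= B -> `|F k x| <= C * K ^+ k * k`!%:R].

Definition entire f := exists F, [/\ F 0%N = f, deriv_seq F & factorial_bound F].

Lemma deriv_seq_shift F : deriv_seq F -> deriv_seq (fun k => F k.+1).
Proof. by move=> FE k x; apply: FE. Qed.

Lemma is_derive_expn_shift a m x : is_derive x 1
  (fun x => (x - a) ^+ m.+1 / m.+1`!%:R) ((x - a) ^+ m / m`!%:R).
Proof.
have d0 : is_derive x 1 (fun y => y - a) 1 := is_derive_shift x 1 (- a).
have d1 := is_deriveZ (m.+1`!%:R^-1) (@is_deriveX R R _ m.+1 x 1 1 d0).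
rewrite (_ : (fun y => _) = m.+1`!%:R^-1 \*: (fun y => y - a) ^+ m.+1).
  apply: is_derive_eq d1 _; rewrite /GRing.scale/= factS natrM; field.
  by rewrite nat1r !pnatr_eq0 -lt0n fact_gt0.
by apply/funext => y; rewrite mulrC /GRing.scale/= exprfctE.
Qed.

(* The two signs reduce the left half of the interval to the right one. *)
Lemma taylor_bound F a h M m : deriv_seq F -> 0 <= h ->
  (forall j, (j < m)%N -> F j a = 0) ->
  (forall x, `|x - a| <= h -> `|F m x| <= M) ->
  forall x, `|x - a| <= h -> `|F 0%N x| <= M * (`|x - a| ^+ m / m`!%:R).
Proof.
move=> + h0; elim: m F => [|m IH] F FE F0 FM x xh.
  by rewrite expr0 fact0 divr1 mulr1 FM.
have {}IH y : `|y - a| <= h -> `|F 1%N y| <= M * (`|y - a| ^+ m / m`!%:R).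
  apply: (IH (fun k => F k.+1)); first exact: deriv_seq_shift.
  - by move=> j jm; apply: F0.
  - exact: FM.
have key (e : bool) (t : R) : 0 <= t <= h ->
    `|F 0%N (a + (-1) ^+ e * t)| <= M * (t ^+ m.+1 / m.+1`!%:R).
  move=> /andP[t0 th].
  (* Here e chooses the side of a, and c the sign of F 0. Each g c vanishes at 0 and has a
     nonnegative derivative by the induction hypothesis; the two inequalities 0 <= g c t bound the
     absolute value. *)
  pose g (c : bool) (t : R) : R := M * ((t - 0) ^+ m.+1 / m.+1`!%:R) +
    (-1) ^+ c * F 0%N (a + (-1) ^+ e * t).
  pose g' (c : bool) (t : R) : R := M * ((t - 0) ^+ m / m`!%:R) +
    (-1) ^+ c * ((-1) ^+ e * F 1%N (a + (-1) ^+ e * t)).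
  have gd (c : bool) (u : R) : is_derive u 1 (g c) (g' c u).
    have d1 := is_derive_expn_shift 0 m u.
    have d3 : is_derive u 1 (fun t => a + (-1) ^+ e * t) ((-1) ^+ e).
      have d0 : is_derive u 1 (fun t => (-1) ^+ e * t) ((-1) ^+ e *: 1) :=
        is_deriveZ ((-1) ^+ e) (is_derive_id u 1).
      apply: is_derive_eq (is_deriveD (is_derive_cst a u 1) d0) _.
      by rewrite /GRing.scale/= mulr1 add0r.
    have d2 : is_derive u 1 (F 0%N \o (fun t => a + (-1) ^+ e * t))
        ((-1) ^+ e * F 1%N (a + (-1) ^+ e * u)).
      by rewrite mulrC; apply: is_derive1_comp.
    have d4 : is_derive u 1 (fun t => M * ((t - 0) ^+ m.+1 / m.+1`!%:R))
       (M * ((u - 0) ^+ m / m`!%:R)) := is_deriveZ M d1.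
    have d5 : is_derive u 1 (fun t => (-1) ^+ c * F 0%N (a + (-1) ^+ e * t))
       ((-1) ^+ c * ((-1) ^+ e * F 1%N (a + (-1) ^+ e * u))) :=
      is_deriveZ ((-1) ^+ c) d2.
    exact: is_deriveD d4 d5.
  have g0 c : g c 0 = 0 by rewrite /g subrr expr0n/= mulr0 addr0 F0// !(mulr0, mul0r) addr0.
  have gt c : 0 <= g c t.
    rewrite -(g0 c); apply: (@derive_ge0_le _ _ (g' c)) => // u /andP[u0 ut].
    have := IH (a + (-1) ^+ e * u).
    rewrite addrAC subrr add0r normrM normrX normrN1 expr1n mul1r ger0_norm//.
    move=> /(_ (le_trans ut th)) hb; rewrite /g' subr0 -lerBlDr sub0r.
    apply: le_trans hb; apply: le_trans (ler_norm _) _.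
    by rewrite normrN !normrM !normrX normrN1 !expr1n !mul1r.
  have := gt false; have := gt true; rewrite /g subr0 expr0 expr1 mul1r mulN1r.
  by rewrite subr_ge0 -lerBlDl sub0r => h1 h2; rewrite ler_norml h1 andbT.
have [xa|xa] := leP a x.
  have xa0 : 0 <= x - a by rewrite subr_ge0.
  have := @key false (x - a); rewrite expr0 mul1r subrKC (ger0_norm xa0); apply.
  by rewrite xa0 -(ger0_norm xa0).
have ax0 : 0 <= a - x by rewrite subr_ge0 ltW.
rewrite distrC (ger0_norm ax0) in xh *.
have := @key true (a - x); rewrite expr1 mulN1r opprB subrKC; apply.
by rewrite ax0.
Qed.

(** A binomial coefficient is one term of the expansion of (1 + 1)^(k + m). *)
Lemma fact_add_le k m : ((k + m)`! <= 2 ^ (k + m) * (k`! * m`!))%N.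
Proof.
rewrite -(@bin_fact (k + m) k) ?leq_addr// addKn leq_mul2r; apply/orP; right.
by rewrite -[2%N]/(1 + 1)%N expnDn (bigD1 (inord k : 'I_(k + m).+1)) //=
   inordK ?ltnS ?leq_addr// !exp1n !muln1 leq_addr.
Qed.

Lemma le_geometric_eq0 (u v : R) : (forall m, `|u| <= v * (2^-1) ^+ m) -> u = 0.
Proof.
move=> uv; apply/eqP; rewrite -normr_le0.
have c : v * (2^-1) ^+ m @[m --> \oo] --> v * 0.
  apply: cvgM; first exact: cvg_cst.
  by apply: cvg_expr; rewrite ger0_norm ?invr_ge0// invf_lt1 ?ltr1n.
rewrite mulr0 in c; rewrite -(cvg_lim _ c)//.
by apply: limr_ge; [exact: cvgP c|apply: nearW].
Qed.

(** The Taylor bound of every order m at a, applied to F k, is at most a constant times (2 K h)^m,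
    and the hypothesis makes 2 K h <= 1/2. All derivatives vanish near a, not only F 0, so the step
    can be iterated; its length depends only on the constant K of the ambient interval. *)
Lemma entire_zero_step F B C K a h : deriv_seq F -> 0 <= C -> 0 <= K -> 0 <= h ->
  (forall k x, `|x| <= B -> `|F k x| <= C * K ^+ k * k`!%:R) ->
  (forall x, `|x - a| <= h -> `|x| <= B) -> K * h * 4 <= 1 ->
  (forall k, F k a = 0) -> forall x, `|x - a| <= h -> forall k, F k x = 0.
Proof.
move=> FE C0 K0 h0 FB hB Kh Fa x xh k.
apply: (@le_geometric_eq0 _ (C * (2 * K) ^+ k * k`!%:R)) => m.
have := @taylor_bound (fun j => F (k + j)%N) a h (C * K ^+ (k + m) * (k + m)`!%:R) m.
move=> /(_ _ h0 _ _ x xh); rewrite addn0.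
have shiftE : deriv_seq (fun j => F (k + j)%N) by move=> j y; rewrite addnS; apply: FE.
move=> /(_ shiftE) hT; apply: le_trans (hT _ _) _.
- by move=> j _; apply: Fa.
- move=> y yh; rewrite FB// hB//.
apply: le_trans (_ : C * K ^+ (k + m) * (k + m)`!%:R * (h ^+ m / m`!%:R) <= _).
  apply: ler_wpM2l; first by rewrite !mulr_ge0// exprn_ge0.
  by rewrite ler_wpM2r ?invr_ge0// lerXn2r ?nnegrE.
apply: le_trans (_ : C * K ^+ (k + m) * (2 ^+ (k + m) * (k`!%:R * m`!%:R)) *
    (h ^+ m / m`!%:R) <= _).
  apply: ler_wpM2r; first by rewrite divr_ge0// exprn_ge0.
  apply: ler_wpM2l; first by rewrite !mulr_ge0// exprn_ge0.
  by rewrite -!natrM -natrX -natrM ler_nat fact_add_le.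
have -> : C * K ^+ (k + m) * (2 ^+ (k + m) * (k`!%:R * m`!%:R)) * (h ^+ m / m`!%:R) =
   (C * (2 * K) ^+ k * k`!%:R) * (2 * (K * h)) ^+ m.
  rewrite !exprD !exprMn; field.
  by rewrite pnatr_eq0 -lt0n fact_gt0.
apply: ler_wpM2l; first by rewrite !mulr_ge0// exprn_ge0// mulr_ge0.
by rewrite lerXn2r ?nnegrE ?mulr_ge0 ?invr_ge0//; lra.
Qed.

Lemma entire_zero F x0 : deriv_seq F -> factorial_bound F ->
  (forall k, F k x0 = 0) -> forall x, F 0%N x = 0.
Proof.
move=> FE FB F0 y.
(* The segment from x0 to y is cut into N steps of length h with 4 K h <= 1. The radius covers the
   segment and, around each of its points, a ball of radius |y - x0| >= h. *)
have [C [K [C0 K0 {}FB]]] := FB (`|x0| + 2 * `|y - x0|).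
pose N := (Num.truncn (K * `|y - x0| * 4)).+1.
have N0 : (0 : R) < N%:R by rewrite ltr0n.
have NK : K * `|y - x0| * 4 <= N%:R.
  by apply: ltW; rewrite /N; have /andP[] := truncn_itv (x := K * `|y - x0| * 4)
    (mulr_ge0 (mulr_ge0 K0 (normr_ge0 _)) (ler0n _ 4)).
have key j : (j <= N)%N -> forall k, F k (x0 + (y - x0) * (j%:R / N%:R)) = 0.
  elim: j => [_ k|j IH jN]; first by rewrite mul0r mulr0 addr0 F0.
  apply: (@entire_zero_step F (`|x0| + 2 * `|y - x0|) C K
    (x0 + (y - x0) * (j%:R / N%:R)) (`|y - x0| / N%:R)) => //.
  - move=> x xh.
    have -> : x = x0 + ((y - x0) * (j%:R / N%:R) +
        (x - (x0 + (y - x0) * (j%:R / N%:R)))) by ring.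
    rewrite (le_trans (ler_normD _ _))// lerD2l.
    rewrite (le_trans (ler_normD _ _))// [2 * _]mulr_natl mulr2n lerD//.
      rewrite normrM ler_piMr// ger0_norm ?divr_ge0 ?(ltW N0)//.
      by rewrite ler_pdivrMr// mul1r ler_nat ltnW.
    rewrite (le_trans xh)// ler_piMr// invf_le1//.
    by rewrite ler1n.
  - by rewrite mulrA mulrAC ler_pdivrMr// mul1r.
  - by apply: IH; exact: ltnW.
  - rewrite opprD addrACA subrr add0r -mulrBr -mulrBl -natrB// subSnn mul1r.
    by rewrite normrM (ger0_norm (x := N%:R^-1)) ?invr_ge0// ltW.
have := key N (leqnn _) 0%N; rewrite divff ?mulr1 ?gt_eqF//.
by rewrite subrKC.
Qed.

(** The mean value theorem transfers the sign of F 1 on the right of x to F 0, because F 0 x = 0;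
    the case m = 0 is continuity. *)
Lemma deriv_seq_right_sign F m x b : deriv_seq F ->
  (forall j, (j < m)%N -> F j x = 0) -> signed b (F m x) -> right_sign (F 0%N) x b.
Proof.
elim: m F => [|m IH] F FE F0 Fm.
  have cF : {for x, continuous (fun y => (-1) ^+ b * F 0%N y)}.
    by apply: (@is_derive_continuous _ _ _ ((-1) ^+ b * F 1%N x)); apply: (is_deriveZ ((-1) ^+ b) (FE 0%N x)).
  have /nbhs_ballP[d /= d0 hd] := cF _ (lt_nbhsr Fm).
  exists d => // y /andP[xy yd]; apply: hd => /=.
  by rewrite /ball/= ltr0_norm ?subr_lt0// opprB ltrBlDl.
have [|||d d0 hd] := IH (fun k => F k.+1).
- exact: deriv_seq_shift.
- by move=> j jm; apply: F0.
- exact: Fm.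
exists d => // y /andP[xy yd].
have [c /andP[xc cy] e] := mean_value xy (fun z _ => FE 0%N z).
rewrite F0// subr0 in e.
rewrite /signed e mulrA mulr_gt0 ?subr_gt0//.
by apply: hd; rewrite xc (lt_trans cy yd).
Qed.

(** On the left of x each use of the mean value theorem reverses the sign, whence [odd m]. *)
Lemma deriv_seq_left_sign F m x b : deriv_seq F ->
  (forall j, (j < m)%N -> F j x = 0) -> signed (b (+) odd m) (F m x) ->
  left_sign (F 0%N) x b.
Proof.
elim: m F b => [|m IH] F b FE F0 Fm.
  rewrite addbF in Fm.
  have cF : {for x, continuous (fun y => (-1) ^+ b * F 0%N y)}.
    by apply: (@is_derive_continuous _ _ _ ((-1) ^+ b * F 1%N x)); apply: (is_deriveZ ((-1) ^+ b) (FE 0%N x)).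
  have /nbhs_ballP[d /= d0 hd] := cF _ (lt_nbhsr Fm).
  exists d => // y /andP[xy yd]; apply: hd => /=.
  by rewrite /ball/= gtr0_norm ?subr_gt0// ltrBlDl -ltrBlDr.
have [|||d d0 hd] := IH (fun k => F k.+1) (~~ b).
- exact: deriv_seq_shift.
- by move=> j jm; apply: F0.
- by move: Fm; rewrite /= addbN -addNb.
exists d => // y /andP[xy yd].
have [c /andP[yc cx] e] := mean_value yd (fun z _ => FE 0%N z).
rewrite F0// sub0r in e.
have -> : F 0%N y = - (F 1%N c * (x - y)) by rewrite -e opprK.
have := hd c; rewrite (lt_trans xy yc) cx => /(_ isT).
rewrite /signed signrN mulNr -mulrN => h.
by rewrite -mulNr mulrA mulr_gt0 ?subr_gt0.
Qed.

Lemma first_nonzero F x : ~ (forall k, F k x = 0) ->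
  exists m, F m x != 0 /\ forall j, (j < m)%N -> F j x = 0.
Proof.
move=> /existsNP[m /eqP Fm].
have ex : exists m, F m x != 0 by exists m.
exists (ex_minn ex); case: ex_minnP => j Fj jmin; split => // i ij.
by apply/eqP; apply: contraTT ij => /jmin; rewrite -leqNgt.
Qed.

Lemma neq0_signed (v : R) : v != 0 -> exists b, signed b v.
Proof.
move=> v0; exists (v < 0); rewrite /signed; case: (ltgtP v 0) v0 => //= h _.
  by rewrite expr1 mulN1r oppr_gt0.
by rewrite expr0 mul1r.
Qed.

(** By the identity theorem some derivative at x is nonzero; the first such one decides the sign. *)
Lemma entire_right_sign F x : deriv_seq F -> factorial_bound F ->
  (exists y, F 0%N y != 0) -> exists b, right_sign (F 0%N) x b.
Proof.
move=> FE FB [y Fy].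
have [|m [Fm Fj]] := @first_nonzero F x.
  by move=> /(entire_zero FE FB) F0; rewrite F0 eqxx in Fy.
have [b sb] := neq0_signed Fm; exists b; exact: deriv_seq_right_sign sb.
Qed.

Lemma entire_left_sign F x : deriv_seq F -> factorial_bound F ->
  (exists y, F 0%N y != 0) -> exists b, left_sign (F 0%N) x b.
Proof.
move=> FE FB [y Fy].
have [|m [Fm Fj]] := @first_nonzero F x.
  by move=> /(entire_zero FE FB) F0; rewrite F0 eqxx in Fy.
have [b sb] := neq0_signed Fm; exists (b (+) odd m).
by apply: (deriv_seq_left_sign FE Fj); rewrite -addbA addbb addbF.
Qed.

End entire_functions.

(** * Sums, products and Gaussians among the entire functions *)

Section entire_closure.
Context {R : realType}.
Implicit Types (F G : nat -> R -> R) (f g : R -> R) (x c C K B : R).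

Lemma is_deriveD_fun f g x (a b : R) : is_derive x 1 f a -> is_derive x 1 g b ->
  is_derive x 1 (fun y => f y + g y) (a + b).
Proof. exact: is_deriveD. Qed.

Lemma is_deriveM_fun f g x (a b : R) : is_derive x 1 f a -> is_derive x 1 g b ->
  is_derive x 1 (fun y => f y * g y) (a * g x + f x * b).
Proof.
move=> fa gb; apply: is_derive_eq (is_deriveM fa gb) _.
by rewrite /GRing.scale/=; ring.
Qed.

Lemma is_deriveZ_fun f x c (a : R) : is_derive x 1 f a ->
  is_derive x 1 (fun y => c * f y) (c * a).
Proof. exact: is_deriveZ. Qed.

Lemma is_derive_sum_fun n (h : 'I_n -> R -> R) (dh : 'I_n -> R) x :
  (forall i, is_derive x 1 (h i) (dh i)) ->
  is_derive x 1 (fun y => \sum_i h i y) (\sum_i dh i).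
Proof.
move=> hd; rewrite (_ : (fun y => _) = \sum_i h i); first exact: is_derive_sum.
by apply/funext => y; rewrite fct_sumE.
Qed.

Lemma entireD f g : entire f -> entire g -> entire (fun x => f x + g x).
Proof.
move=> [F [<- FE FB]] [G [<- GE GB]].
exists (fun k x => F k x + G k x); split=> // [k x|B].
  exact: is_deriveD_fun.
have [C [K [C0 K0 hF]]] := FB B; have [D [L [D0 L0 hG]]] := GB B.
exists (C + D), (K + L); split; rewrite ?addr_ge0// => k x xB.
rewrite (le_trans (ler_normD _ _))// !mulrDl lerD//.
- rewrite (le_trans (hF _ _ xB))// ler_wpM2r// ler_wpM2l//.
  by rewrite lerXn2r ?nnegrE ?addr_ge0// lerDl.
- rewrite (le_trans (hG _ _ xB))// ler_wpM2r// ler_wpM2l//.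
  by rewrite lerXn2r ?nnegrE ?addr_ge0// lerDr.
Qed.

Lemma entireZ c f : entire f -> entire (fun x => c * f x).
Proof.
move=> [F [<- FE FB]]; exists (fun k x => c * F k x); split=> // [k x|B].
  exact: is_deriveZ_fun.
have [C [K [C0 K0 hF]]] := FB B.
exists (`|c| * C), K; split; rewrite ?mulr_ge0// => k x xB.
by rewrite normrM -!mulrA ler_wpM2l// mulrA hF.
Qed.

Lemma entire_cst c : entire (fun=> c).
Proof.
exists (fun k _ => if k is 0%N then c else 0); split=> // [k x|B].
  by case: k => [|k]; exact: is_derive_cst.
exists `|c|, 1; split=> // -[|k] x _; first by rewrite expr0 fact0 !mulr1.
by rewrite normr0 expr1n !mulr_ge0.
Qed.

Lemma entire_sum n (f : 'I_n -> R -> R) :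
  (forall i, entire (f i)) -> entire (fun x => \sum_i f i x).
Proof.
elim: n f => [|n IH] f fE.
  by under eq_fun do rewrite big_ord0; exact: entire_cst.
under eq_fun do rewrite big_ord_recl.
by apply: entireD => //; apply: IH.
Qed.

Definition leibniz F G k x := \sum_(i < k.+1) 'C(k, i)%:R * (F i x * G (k - i)%N x).

Lemma leibniz_deriv_seq F G : deriv_seq F -> deriv_seq G -> deriv_seq (leibniz F G).
Proof.
move=> FE GE k x; pose a i j := F i x * G j x.
have d i : is_derive x 1 (fun x => 'C(k, i)%:R * (F i x * G (k - i)%N x))
  ('C(k, i)%:R * (a i.+1 (k - i)%N + a i (k - i).+1)).
  by apply: is_deriveZ_fun; apply: is_deriveM_fun.
have := is_derive_sum_fun (fun i : 'I_k.+1 => d i).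
move=> h; apply: is_derive_eq h _.
under eq_bigr do rewrite mulrDr.
rewrite big_split/= /leibniz [RHS]big_ord_recl bin0 mul1r subn0.
under [in RHS]eq_bigr => i _ do
  rewrite /= /bump leq0n add1n binS natrD mulrDl subSS -/(a _ _).
rewrite big_split/= [RHS]addrA [RHS]addrC; congr (_ + _).
rewrite big_ord_recl bin0 subn0 mul1r; congr (_ + _).
rewrite [RHS]big_ord_recr/= bin_small// mul0r addr0.
by apply: eq_bigr => i _; rewrite /= /bump leq0n add1n -subSn// subSS.
Qed.

(** The product of 'C(k, i), i! and (k - i)! is k!, which leaves the sum of the L^(k - i) K^i.
    Binomial coefficients being at least 1, this sum is at most (L + K)^k. *)
Lemma leibniz_factorial_bound F G :
  factorial_bound F -> factorial_bound G -> factorial_bound (leibniz F G).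
Proof.
move=> FB GB B.
have [C [K [C0 K0 hF]]] := FB B; have [D [L [D0 L0 hG]]] := GB B.
exists (C * D), (L + K); split; rewrite ?addr_ge0 ?mulr_ge0// => k x xB.
rewrite exprDn mulr_sumr mulr_suml (le_trans (ler_norm_sum _ _ _))//.
apply: ler_sum => i _; rewrite !normrM.
have ik : (i <= k)%N by rewrite -ltnS.
rewrite (ger0_norm (ler0n _ _)).
apply: le_trans (_ : 'C(k, i)%:R * ((C * K ^+ i * i`!%:R) *
    (D * L ^+ (k - i) * (k - i)`!%:R)) <= _).
  by rewrite ler_wpM2l// ler_pM// ?hF ?hG.
have -> : 'C(k, i)%:R * ((C * K ^+ i * i`!%:R) * (D * L ^+ (k - i) * (k - i)`!%:R)) =
   C * D * (L ^+ (k - i) * K ^+ i) * k`!%:R.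
  by rewrite -(bin_fact ik) !natrM; ring.
rewrite ler_wpM2r// ler_wpM2l ?mulr_ge0// -[leRHS]mulr_natl.
by rewrite ler_peMl ?mulr_ge0 ?exprn_ge0// ler1n bin_gt0.
Qed.

Lemma entireM f g : entire f -> entire g -> entire (fun x => f x * g x).
Proof.
move=> [F [<- FE FB]] [G [<- GE GB]]; exists (leibniz F G); split.
- by apply/funext => x; rewrite /leibniz big_ord1 bin0 mul1r.
- exact: leibniz_deriv_seq.
- exact: leibniz_factorial_bound.
Qed.

(* The Hermite recurrence for the derivatives of a Gaussian. *)
Fixpoint gauss_seq c (k : nat) (x : R) : R :=
  match k with
  | 0%N => expR (- (c * x ^+ 2))
  | k1.+1 => - (2 * c) * (x * gauss_seq c k1 x +
      if k1 is k2.+1 then k1%:R * gauss_seq c k2 x else 0)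
  end.

Lemma gauss_seqSS c k x : gauss_seq c k.+2 x =
  - (2 * c) * (x * gauss_seq c k.+1 x + k.+1%:R * gauss_seq c k x).
Proof. by []. Qed.

Lemma gauss_seq_deriv c : deriv_seq (gauss_seq c).
Proof.
move=> k x; suff [] : is_derive x 1 (gauss_seq c k) (gauss_seq c k.+1 x) /\
  is_derive x 1 (gauss_seq c k.+1) (gauss_seq c k.+2 x) by [].
have did := is_derive_id x (1 : R).
have step j : is_derive x 1 (gauss_seq c j) (gauss_seq c j.+1 x) ->
    is_derive x 1 (fun y => y * gauss_seq c j y)
      (gauss_seq c j x + x * gauss_seq c j.+1 x).
  by move=> h; apply: is_derive_eq (is_deriveM_fun did h) _; rewrite mul1r.
elim: k => [|k [IH1 IH2]].
  have d0 : is_derive x 1 (gauss_seq c 0) (gauss_seq c 1 x).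
    have d1 := is_deriveZ_fun (- c) (is_deriveM_fun did did).
    have := is_derive1_comp (is_derive_expR _) d1.
    rewrite (_ : _ \o _ = gauss_seq c 0); last first.
      by apply/funext => y /=; rewrite expr2 mulNr.
    move=> h; apply: is_derive_eq h _ => /=.
    by rewrite expr2 mulNr; ring.
  split=> //.
  have d2 := is_deriveZ_fun (- (2 * c)) (step _ d0).
  rewrite (_ : gauss_seq c 1 = fun y => - (2 * c) * (y * gauss_seq c 0 y)); last first.
    by apply/funext => y /=; rewrite addr0.
  by apply: is_derive_eq d2 _ => /=; ring.
split=> //.
have := is_deriveZ_fun (- (2 * c))
  (is_deriveD_fun (step _ IH2) (is_deriveZ_fun k.+1%:R IH1)).
move=> h; apply: is_derive_eq h _.
rewrite [RHS]gauss_seqSS.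
move: (gauss_seq c k.+2 x) (gauss_seq c k.+1 x) => u v.
by rewrite -(natr1 k.+1); ring.
Qed.

Lemma gauss_seq_bound c : 0 <= c -> factorial_bound (gauss_seq c).
Proof.
(* Chosen so that K^2 >= 2 c |B| K + 2 c, the inequality by which the two-term recurrence propagates
   the bound. *)
move=> c0 B; pose K := 2 * c * `|B| + 2 * c + 1.
have cB : 0 <= 2 * c * `|B| by rewrite !mulr_ge0.
have c2 : 0 <= 2 * c by rewrite mulr_ge0.
have K0 : 0 <= K by rewrite !addr_ge0.
exists 1, K; split=> // k x xB; rewrite mul1r.
have {}xB : `|x| <= `|B| by rewrite (le_trans xB)// ler_norm.
suff [] : `|gauss_seq c k x| <= K ^+ k * k`!%:R /\
  `|gauss_seq c k.+1 x| <= K ^+ k.+1 * k.+1`!%:R by [].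
have e0 : `|gauss_seq c 0 x| <= 1.
  rewrite /= ger0_norm ?expR_ge0// -[leRHS]expR0 ler_expR oppr_le0.
  by rewrite mulr_ge0// sqr_ge0.
elim: k => [|k [IH1 IH2]].
  rewrite expr0 fact0 !mulr1; split=> //.
  rewrite [gauss_seq c 1 x]/= addr0 !normrM normrN expr1.
  rewrite (ger0_norm c2).
  apply: le_trans (_ : 2 * c * (`|B| * 1) <= _); first by rewrite ler_wpM2l// ler_pM.
  by rewrite mulr1 /K -addrA lerDl addr_ge0.
split=> //.
rewrite gauss_seqSS normrM normrN (ger0_norm c2).
apply: le_trans (_ : 2 * c * (`|B| * (K ^+ k.+1 * k.+1`!%:R) +
   k.+1%:R * (K ^+ k * k`!%:R)) <= _).
  rewrite ler_wpM2l// (le_trans (ler_normD _ _))// lerD//.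
    by rewrite normrM ler_pM.
  by rewrite normrM (ger0_norm (ler0n _ _)) ler_wpM2l.
have -> : 2 * c * (`|B| * (K ^+ k.+1 * k.+1`!%:R) + k.+1%:R * (K ^+ k * k`!%:R)) =
   (K ^+ k * k.+1`!%:R) * (2 * c * `|B| * K + 2 * c).
  by rewrite factS natrM exprS; ring.
apply: le_trans (_ : (K ^+ k * k.+1`!%:R) * (K * K) <= _).
  rewrite ler_wpM2l ?mulr_ge0 ?exprn_ge0//.
  have -> : K * K = 2 * c * `|B| * K + 2 * c + ((2 * c + 1) * (K - 1) + 1) by rewrite /K; ring.
  rewrite lerDl addr_ge0// mulr_ge0 ?(addr_ge0 c2)//.
  by rewrite /K addrK addr_ge0.
rewrite [k.+2`!]factS natrM !exprS -!mulrA.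
rewrite (_ : K * (K * _) = (K ^+ k * (k.+1)`!%:R * (K * K)) * k.+2%:R); last by ring.
rewrite !mulrA ler_peMr ?mulr_ge0 ?exprn_ge0// ler1n//.
Qed.

Lemma entire_gauss c : 0 <= c -> entire (fun x => expR (- (c * x ^+ 2))).
Proof.
move=> c0; exists (gauss_seq c); split=> //; first exact: gauss_seq_deriv.
exact: gauss_seq_bound.
Qed.

(* With f = F 0, the function 3 f' + x f'' and its derivatives.  Its sign is
   that of the second derivative of P |-> f (P^(-1/2)) at x = P^(-1/2). *)
Definition inflection_seq F j x := (3 + j)%:R * F j.+1 x + x * F j.+2 x.

Lemma inflection_deriv_seq F : deriv_seq F -> deriv_seq (inflection_seq F).
Proof.
move=> FE j x; have := is_deriveD_fun (is_deriveZ_fun (3 + j)%:R (FE j.+1 x))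
  (is_deriveM_fun (is_derive_id x 1) (FE j.+2 x)).
move=> h; apply: is_derive_eq h _; rewrite /inflection_seq addnS -natr1.
by ring.
Qed.

(** The factor 3 + j and the shift of the index cost a multiple of (j + 1)^2, and j + 1 <= 2^j turns
    this into 4^j: hence the constant 4 K. *)
Lemma inflection_factorial_bound F : factorial_bound F -> factorial_bound (inflection_seq F).
Proof.
move=> FB B; have [C [K [C0 K0 hF]]] := FB B.
exists (3 * C * K + 2 * `|B| * C * K ^+ 2), (4 * K).
split; rewrite ?addr_ge0 ?mulr_ge0 ?exprn_ge0// => j x xB.
have j2 : (j.+1)%:R <= 2 ^+ j :> R by rewrite -natrX ler_nat ltn_expl.
have e4 : (4 * K) ^+ j = 2 ^+ j * 2 ^+ j * K ^+ j.
  by rewrite -!exprMn; congr (_ ^+ _); ring.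
have jj : j.+1%:R * j.+1%:R <= 2 ^+ j * 2 ^+ j :> R by rewrite ler_pM.
rewrite mulrDl mulrDl (le_trans (ler_normD _ _))// lerD//.
  rewrite normrM (ger0_norm (ler0n _ _)).
  apply: le_trans (_ : (3 * j.+1%:R) * (C * K ^+ j.+1 * j.+1`!%:R) <= _).
    apply: ler_pM => //; last exact: hF.
    by rewrite -natrM ler_nat mulnS leq_add2l leq_pmull.
  rewrite factS natrM exprS e4.
  have -> : 3 * j.+1%:R * (C * (K * K ^+ j) * (j.+1%:R * j`!%:R)) =
    (3 * C * K * K ^+ j * j`!%:R) * (j.+1%:R * j.+1%:R) by ring.
  have -> : 3 * C * K * (2 ^+ j * 2 ^+ j * K ^+ j) * j`!%:R =
    (3 * C * K * K ^+ j * j`!%:R) * (2 ^+ j * 2 ^+ j) by ring.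
  by apply: ler_wpM2l => //; rewrite !mulr_ge0// exprn_ge0.
rewrite normrM.
apply: le_trans (_ : `|B| * (C * K ^+ j.+2 * j.+2`!%:R) <= _).
  by apply: ler_pM => //; [rewrite (le_trans xB)// ler_norm|exact: hF].
apply: le_trans (_ : `|B| * (C * K ^+ j.+2 * (2 * j.+1%:R * j.+1`!%:R)) <= _).
  have f2 : j.+2`!%:R <= 2 * j.+1%:R * j.+1`!%:R :> R.
    rewrite factS natrM ler_wpM2r// -natrM ler_nat.
    by rewrite mul2n -addnn addSn addnS !ltnS leq_addr.
  by rewrite ler_wpM2l// ler_wpM2l// mulr_ge0// exprn_ge0.
rewrite factS natrM !exprS e4.
have -> : `|B| * (C * (K * (K * K ^+ j)) * (2 * j.+1%:R * (j.+1%:R * j`!%:R))) =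
  (2 * `|B| * C * K ^+ 2 * K ^+ j * j`!%:R) * (j.+1%:R * j.+1%:R) by ring.
have -> : 2 * `|B| * C * (K * (K * 1)) * (2 ^+ j * 2 ^+ j * K ^+ j) * j`!%:R =
  (2 * `|B| * C * K ^+ 2 * K ^+ j * j`!%:R) * (2 ^+ j * 2 ^+ j) by ring.
by apply: ler_wpM2l => //; rewrite !mulr_ge0// exprn_ge0.
Qed.

End entire_closure.

(** * Polyhedra as signed sums of cones *)

Section dotv_theory.
Context {R : realType} {n : nat}.
Implicit Types u v w : 'rV[R]_n.

Lemma dotvE u v : dotv u v = \sum_i u ord0 i * v ord0 i.
Proof. by rewrite /dotv mxE; apply: eq_bigr => i _; rewrite mxE. Qed.

Lemma dotvDl u v w : dotv (u + v) w = dotv u w + dotv v w.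
Proof. by rewrite /dotv mulmxDl mxE. Qed.

Lemma dotvZl c u v : dotv (c *: u) v = c * dotv u v.
Proof. by rewrite /dotv -scalemxAl mxE. Qed.

Lemma dotvC u v : dotv u v = dotv v u.
Proof. by rewrite !dotvE; apply: eq_bigr => i _; rewrite mulrC. Qed.

Lemma dotvDr u v w : dotv u (v + w) = dotv u v + dotv u w.
Proof. by rewrite dotvC dotvDl !(dotvC u). Qed.

Lemma dotvZr c u v : dotv u (c *: v) = c * dotv u v.
Proof. by rewrite dotvC dotvZl dotvC. Qed.

Lemma dotvNl u v : dotv (- u) v = - dotv u v.
Proof. by rewrite -scaleN1r dotvZl mulN1r. Qed.

Lemma dotvNr u v : dotv u (- v) = - dotv u v.
Proof. by rewrite dotvC dotvNl dotvC. Qed.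

Lemma dotv_ge0 u : 0 <= dotv u u.
Proof. by rewrite dotvE sumr_ge0// => i _; rewrite -expr2 sqr_ge0. Qed.

Lemma dotv_eq0 u : (dotv u u == 0) = (u == 0).
Proof.
apply/eqP/eqP => [|->]; last by rewrite -(scale0r (0 : 'rV[R]_n)) dotvZl mul0r.
rewrite dotvE => /eqP; rewrite psumr_eq0; last by move=> i _; rewrite -expr2 sqr_ge0.
move=> /allP h; apply/rowP => i; rewrite mxE; apply/eqP.
by have := h i; rewrite mem_index_enum => /(_ isT)/=; rewrite mulf_eq0 orbb.
Qed.

Lemma sqr_enorm u : enorm u ^+ 2 = dotv u u.
Proof. by rewrite /enorm sqr_sqrtr// dotv_ge0. Qed.

Lemma enorm_ge0 u : 0 <= enorm u. Proof. exact: sqrtr_ge0. Qed.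

Lemma enorm_eq0 u : (enorm u == 0) = (u == 0).
Proof. by rewrite -dotv_eq0 -sqr_enorm sqrf_eq0. Qed.

Lemma enormZ c u : enorm (c *: u) = `|c| * enorm u.
Proof.
by rewrite /enorm dotvZl dotvZr mulrA -expr2 sqrtrM ?sqr_ge0// sqrtr_sqr.
Qed.

Lemma cauchy_schwarz_dotv u v : dotv u v ^+ 2 <= dotv u u * dotv v v.
Proof.
have [->|u0] := eqVneq u 0.
  by rewrite -(scale0r (0 : 'rV[R]_n)) !dotvZl !mul0r expr0n.
have u0' : 0 < dotv u u by rewrite lt_def dotv_eq0 u0 dotv_ge0.
have := dotv_ge0 (dotv u u *: v - dotv u v *: u).
rewrite !(dotvDl, dotvDr, dotvNl, dotvNr, dotvZl, dotvZr) (dotvC v u) => h.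
have : 0 <= dotv u u * (dotv u u * dotv v v - dotv u v ^+ 2) by nra.
by rewrite pmulr_rge0// subr_ge0.
Qed.

Lemma measurable_dotv (a : 'rV[R]_n) :
  measurable_fun [set: 'rV[R]_n] (fun x => dotv a x : measurableTypeR R).
Proof.
under eq_fun do rewrite dotvE.
apply: measurable_sum => i; apply: measurable_funM; first exact: measurable_cst.
exact: measurable_coord.
Qed.

Lemma measurable_dotvv :
  measurable_fun [set: 'rV[R]_n] (fun x => dotv x x : measurableTypeR R).
Proof.
under eq_fun do rewrite dotvE.
by apply: measurable_sum => i; apply: measurable_funM; exact: measurable_coord.
Qed.

End dotv_theory.

Section row_tail.
Context {R : realType} {n : nat}.
Implicit Types x y : 'rV[R]_n.+1.

Definition rtail x : 'rV[R]_n := (rV_uncons x).2.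

Lemma rtailE x j : rtail x ord0 j = x ord0 (lift ord0 j).
Proof. by rewrite mxE. Qed.

Lemma rtailB x y : rtail (x - y) = rtail x - rtail y.
Proof. by apply/rowP => j; rewrite !(mxE, rtailE). Qed.

Lemma rtailZ c x : rtail (c *: x) = c *: rtail x.
Proof. by apply/rowP => j; rewrite !(mxE, rtailE). Qed.

Lemma rtail_cons p : rtail (rV_cons p) = p.2.
Proof. by rewrite /rtail rV_consK. Qed.

Lemma dotv_rtail x y : dotv x y = x ord0 ord0 * y ord0 ord0 + dotv (rtail x) (rtail y).
Proof.
by rewrite !dotvE big_ord_recl; congr (_ + _); apply: eq_bigr => i _; rewrite !rtailE.
Qed.

Lemma measurable_rtail : measurable_fun setT rtail.
Proof. exact: (measurableT_comp measurable_snd measurable_rV_uncons). Qed.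

End row_tail.

(* The decomposition of a polyhedron into translated cones eliminates one
   coordinate at a time, as in Fourier-Motzkin elimination; it is exact, with
   no exceptional null set, which is why strict inequalities are tracked. *)
Section cone_decomposition.
Context {R : realType}.

(** Only positive factors are allowed, so that sets cut out by strict homogeneous inequalities,
    which miss the apex, qualify. *)
Definition cone n (C : set 'rV[R]_n) :=
  measurable C /\ forall t x, 0 < t -> C x -> C (t *: x).

Inductive cone_span n : ('rV[R]_n -> R) -> Prop :=
| cone_span0 : cone_span (fun=> 0)
| cone_span_add c w C f : cone C -> cone_span f ->
    cone_span (fun x => c * \1_C (x - w) + f x).

(** The algebra generated by the indicators of closed half-spaces. It contains complements and
    products, hence every case distinction that the elimination of a coordinate produces. *)
Inductive polyfun n : ('rV[R]_n -> R) -> Prop :=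
| polyfun_half (a : 'rV[R]_n) (b : R) : polyfun (fun x => (dotv a x <= b)%R%:R)
| polyfun_cst c : polyfun (fun=> c)
| polyfunD f g : polyfun f -> polyfun g -> polyfun (fun x => f x + g x)
| polyfunM f g : polyfun f -> polyfun g -> polyfun (fun x => f x * g x).

Lemma cone_spanD n (f g : 'rV[R]_n -> R) : cone_span f -> cone_span g ->
  cone_span (fun x => f x + g x).
Proof.
move=> fs gs; elim: fs => [|c w C h Cc _ IH].
  by under eq_fun do rewrite add0r.
by under eq_fun do rewrite -addrA; exact: cone_span_add.
Qed.

Lemma cone_span1 n c w (C : set 'rV[R]_n) : cone C ->
  cone_span (fun x => c * \1_C (x - w)).
Proof.
move=> Cc; have := cone_span_add c w Cc (cone_span0 n).
by under eq_fun do rewrite addr0.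
Qed.

Lemma polyfunB n (f g : 'rV[R]_n -> R) : polyfun f -> polyfun g ->
  polyfun (fun x => f x - g x).
Proof.
move=> fp gp; rewrite (_ : (fun x => _) = fun x => f x + (-1) * g x).
  by apply: polyfunD => //; apply: polyfunM => //; exact: polyfun_cst.
by apply/funext => x; rewrite mulN1r.
Qed.

Lemma polyfun_lteif n (a1 a2 : 'rV[R]_n) b1 b2 (e : bool) :
  polyfun (fun x => (dotv a1 x + b1 < dotv a2 x + b2 ?<= if e)%R%:R).
Proof.
case: e.
  rewrite (_ : (fun x => _) = fun x => (dotv (a1 - a2) x <= b2 - b1)%R%:R).
    exact: polyfun_half.
  apply/funext => x; congr (_%:R); congr nat_of_bool.
  by rewrite dotvDl dotvNl /= lerBrDr addrAC lerBlDl addrC.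
rewrite (_ : (fun x => _) = fun x => 1 - (dotv (a2 - a1) x <= b1 - b2)%R%:R).
  by apply: polyfunB; [exact: polyfun_cst|exact: polyfun_half].
apply/funext => x; rewrite dotvDl dotvNl /= ltNge.
rewrite lerBrDr addrAC lerBlDl addrC.
by case: (_ <= _); rewrite ?subrr ?subr0.
Qed.

(** The normal form with respect to the first coordinate: every summand bounds it at most once, from
    above, by an affine function of the tail, with a polyhedral coefficient in the tail. *)
Inductive slab n : ('rV[R]_n.+1 -> R) -> Prop :=
| slab_cyl p : polyfun p -> slab (fun x => p (rtail x))
| slab_below p (a : 'rV[R]_n) (b : R) e : polyfun p -> slab (fun x : 'rV[R]_n.+1 =>
    (x ord0 ord0 < dotv a (rtail x) + b ?<= if e)%R%:R * p (rtail x))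
| slabD f g : slab f -> slab g -> slab (fun x => f x + g x).

Lemma slab_cylM n p (f : 'rV[R]_n.+1 -> R) : polyfun p -> slab f ->
  slab (fun x => p (rtail x) * f x).
Proof.
move=> pp; elim=> [q qp|q a b e qp|g h _ IHg _ IHh].
- exact: (slab_cyl (polyfunM pp qp)).
- under eq_fun do rewrite mulrCA.
  exact: (slab_below a b e (polyfunM pp qp)).
- under eq_fun do rewrite mulrDr.
  exact: slabD.
Qed.

Lemma slab_belowM n a b e (f : 'rV[R]_n.+1 -> R) : slab f ->
  slab (fun x : 'rV[R]_n.+1 => (x ord0 ord0 < dotv a (rtail x) + b ?<= if e)%R%:R * f x).
Proof.
elim=> [q qp|q a' b' e' qp|g h _ IHg _ IHh].
- exact: (slab_below a b e qp).
(* Two upper bounds amount to the smaller one, and [le1] tells, in terms of the tail, whether this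
   is the first. At a tie the strict bound has to win, which fixes the flag [~~ e || e']. *)
- pose le1 (x : 'rV[R]_n) : R :=
    (dotv a x + b < dotv a' x + b' ?<= if (~~ e || e'))%R%:R.
  have l1 : polyfun le1 by exact: polyfun_lteif.
  rewrite (_ : (fun x => _) = fun x : 'rV[R]_n.+1 =>
    (x ord0 ord0 < dotv a (rtail x) + b ?<= if e)%R%:R *
      (le1 (rtail x) * q (rtail x)) +
    (x ord0 ord0 < dotv a' (rtail x) + b' ?<= if e')%R%:R *
      ((1 - le1 (rtail x)) * q (rtail x))).
    apply: slabD; [apply: slab_below (fun x => le1 x * q x) _ _ _ _|
      apply: slab_below (fun x => (1 - le1 x) * q x) _ _ _ _].
    - exact: polyfunM.
    - by apply: polyfunM => //; apply: polyfunB => //; exact: polyfun_cst.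
  apply/funext => x; rewrite !mulrA -mulrDl; congr (_ * _); rewrite /le1.
  move: (x ord0 ord0) (dotv a _ + b) (dotv a' _ + b') => t u u'.
  case: e {le1 l1}; case: e' => /=; case: (ltgtP u u') => uu;
    (case: (ltgtP t u) => tu; case: (ltgtP t u') => tu' //=;
     rewrite ?(mulr0, mulr1, mul0r, addr0, subrr, subr0, add0r)//; try lra).
- under eq_fun do rewrite mulrDr.
  exact: slabD.
Qed.

Lemma slabM n (f g : 'rV[R]_n.+1 -> R) : slab f -> slab g ->
  slab (fun x => f x * g x).
Proof.
move=> fs gs; elim: fs => [q qp|q a b e qp|h k _ IHg _ IHh].
- exact: slab_cylM.
- under eq_fun do rewrite -mulrA.
  by apply: slab_belowM; exact: slab_cylM.
- under eq_fun do rewrite mulrDl.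
  exact: slabD.
Qed.

(** A half-space bounds the first coordinate from above, from below or not at all, according to the
    sign of its leading coefficient. A lower bound is 1 minus a strict upper bound. *)
Lemma polyfun_slab n (f : 'rV[R]_n.+1 -> R) : polyfun f -> slab f.
Proof.
elim=> [a b|c|g h _ IHg _ IHh|g h _ IHg _ IHh].
- case: (ltgtP (a ord0 ord0) 0) => a0.
  + rewrite (_ : (fun x => _) = fun x : 'rV[R]_n.+1 => 1 + (x ord0 ord0 <
      dotv (- (a ord0 ord0)^-1 *: rtail a) (rtail x) + b / a ord0 ord0 ?<= if false)%R%:R * (-1)).
      apply: slabD; first exact: (slab_cyl (polyfun_cst _ 1)).
      exact: (slab_below _ _ _ (polyfun_cst _ (-1))).
    apply/funext => x; rewrite dotv_rtail dotvZl /= ltNge mulrN1.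
    set d := dotv _ _.
    have -> : (- (a ord0 ord0)^-1 * d + b / a ord0 ord0 <= x ord0 ord0) =
        (a ord0 ord0 * x ord0 ord0 + d <= b).
      rewrite (_ : - _ * d + _ = (b - d) / a ord0 ord0); last by ring.
      by rewrite ler_ndivrMr// lerBrDr mulrC.
    by case: (_ <= _); rewrite ?subrr ?subr0.
  + rewrite (_ : (fun x => _) = fun x : 'rV[R]_n.+1 => (x ord0 ord0 <
      dotv (- (a ord0 ord0)^-1 *: rtail a) (rtail x) + b / a ord0 ord0 ?<= if true)%R%:R * 1).
      exact: (slab_below _ _ _ (polyfun_cst _ 1)).
    apply/funext => x; rewrite dotv_rtail dotvZl /= mulr1.
    set d := dotv _ _; congr (_%:R); congr nat_of_bool.
    rewrite (_ : - _ * d + _ = (b - d) / a ord0 ord0); last by ring.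
    by rewrite ler_pdivlMr// lerBrDr mulrC.
  + rewrite (_ : (fun x => _) = fun x => (dotv (rtail a) (rtail x) <= b)%R%:R).
      exact: (slab_cyl (polyfun_half _ _)).
    by apply/funext => x; rewrite dotv_rtail a0 mul0r add0r.
- exact: (slab_cyl (polyfun_cst _ c)).
- exact: slabD.
- exact: slabM.
Qed.

Lemma cone_cyl n (C : set 'rV[R]_n) : cone C -> cone (rtail @^-1` C).
Proof.
move=> [mC Ct]; split; last by move=> t x t0 /=; rewrite rtailZ; exact: Ct.
by rewrite -[X in measurable X]setTI; exact: measurable_rtail.
Qed.

Lemma cone_below n (a : 'rV[R]_n) e (C : set 'rV[R]_n) : cone C ->
  cone (rtail @^-1` C `&` [set x : 'rV[R]_n.+1 | x ord0 ord0 < dotv a (rtail x) ?<= if e]).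
Proof.
move=> Cc; have [mC Ct] := cone_cyl Cc; split; last first.
  move=> t x t0 [Cx ax]; split; first exact: Ct.
  by move: ax; rewrite /= rtailZ dotvZr mxE; case: e => /=; rewrite ?ler_pM2l ?ltr_pM2l.
apply: measurableI => //.
have mf : measurable_fun [set: 'rV[R]_n.+1]
    (fun x => dotv a (rtail x) - (x : 'rV[R]_n.+1) ord0 ord0 : measurableTypeR R).
  apply: measurable_funB; last exact: measurable_coord.
  exact: (measurableT_comp (measurable_dotv a) measurable_rtail).
case: e => /=.
- rewrite (_ : [set x | _] = (fun x : 'rV[R]_n.+1 => dotv a (rtail x) - x ord0 ord0) @^-1` `[0, +oo[).
    by rewrite -[X in measurable X]setTI; exact: mf.
  by apply/seteqP; split => x /=; rewrite in_itv/= andbT subr_ge0.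
- rewrite (_ : [set x | _] = (fun x : 'rV[R]_n.+1 => dotv a (rtail x) - x ord0 ord0) @^-1` `]0, +oo[).
    by rewrite -[X in measurable X]setTI; exact: mf.
  by apply/seteqP; split => x /=; rewrite in_itv/= andbT subr_gt0.
Qed.

Lemma indic_preimage n m (g : 'rV[R]_n -> 'rV[R]_m) C x :
  \1_(g @^-1` C) x = \1_C (g x) :> R.
Proof.
by rewrite !indicE; congr (_%:R); congr nat_of_bool; apply/idP/idP; rewrite !inE.
Qed.

(** Induction on the dimension, starting from dimension 0 where every function is constant. Over a
    translated cone w + C of the tail space, the cylinder is a translated cone with apex (0, w). The
    part below an affine graph is one with apex (a.w + b, w) on the graph, and seen from there the
    affine bound is linear. *)
Lemma polyfun_cone_span n (f : 'rV[R]_n -> R) : polyfun f -> cone_span f.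
Proof.
elim: n f => [|n IH] f fp.
  have CT : cone [set: 'rV[R]_0] by split.
  have := cone_span1 (f 0) 0 CT.
  by congr cone_span; apply/funext => x; rewrite indicT mulr1; congr f;
    apply/rowP => -[].
elim: (polyfun_slab fp) => [p /IH|p a b e /IH|g h _ IHg _ IHh].
- elim=> [|c w C g Cc _ IHg]; first exact: cone_span0.
  apply: cone_spanD => //.
  have := cone_span1 c (rV_cons (0, w)) (cone_cyl Cc).
  congr cone_span; apply/funext => x; congr (_ * _).
  by rewrite indic_preimage rtailB rtail_cons.
- elim=> [|c w C g Cc _ IHg].
    by under eq_fun do rewrite mulr0; exact: cone_span0.
  under eq_fun do rewrite mulrDr.
  apply: cone_spanD => //.
  have := cone_span1 c (rV_cons (dotv a w + b, w)) (cone_below a e Cc).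
  congr cone_span; apply/funext => x.
  rewrite [RHS]mulrCA; congr (_ * _).
  rewrite indicI /= mulrC indic_preimage rtailB rtail_cons; congr (_ * _).
  rewrite indicE; congr (_%:R); congr nat_of_bool.
  apply/idP/idP; rewrite inE/= rtailB rtail_cons dotvDr dotvNr mxE mxE rV_cons0/=;
    clear -e; case: e => /=; rewrite ?lerBlDr ?ltrBlDr; rewrite [_ + (_ + b)]addrA subrK//.
- exact: cone_spanD.
Qed.

End cone_decomposition.

(** * Lebesgue and Gaussian measures *)

Section lebesgue_rV_theory.
Context {R : realType}.
Local Open Scope ereal_scope.

Local Notation lambda := (@lebesgue_measure R).

Lemma integral_lebesgue_rV0 (f : 'rV[R]_0 -> \bar R) :
  measurable_fun setT f -> \int[lebesgue_rV 0]_x f x = f 0%R.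
Proof. by move=> mf; rewrite integral_dirac// diracT mul1e. Qed.

Lemma integral_lebesgue_rVS n (f : 'rV[R]_n.+1 -> \bar R) :
  measurable_fun setT f -> (forall x, 0 <= f x) ->
  \int[lebesgue_rV n.+1]_x f x =
  \int[lambda]_t \int[lebesgue_rV n]_y f (rV_cons (t, y)).
Proof.
move=> mf f0.
have mc := @measurable_rV_cons R n.
transitivity (\int[pushforward (lambda \x lebesgue_rV n) rV_cons]_x f x).
  by apply: eq_measure_integral.
rewrite ge0_integral_pushforward// preimage_setT fubini_tonelli1//.
- exact: measurableT_comp.
- by move=> x; exact: f0.
Qed.

Lemma measurable_fun_lebesgue_rVS n (f : 'rV[R]_n.+1 -> \bar R) :
  measurable_fun setT f -> (forall x, 0 <= f x) ->
  measurable_fun setT (fun t : measurableTypeR R => \int[lebesgue_rV n]_y f (rV_cons (t, y))).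
Proof.
move=> mf f0; have mc := @measurable_rV_cons R n.
apply: (@measurable_fun_fubini_tonelli_F _ _ _ _ _ _ (f \o rV_cons)) => [|x].
- exact: measurableT_comp.
- exact: f0.
Qed.

Lemma measurable_cons_section n (f : 'rV[R]_n.+1 -> \bar R) t :
  measurable_fun setT f -> measurable_fun setT (fun y => f (rV_cons (t, y))).
Proof.
move=> mf; apply: (measurableT_comp mf).
apply: (measurableT_comp (@measurable_rV_cons R n)).
exact: measurable_pair1.
Qed.

(** The image of Lebesgue measure under t -> a t + b, multiplied by a, gives each half-open interval
    its length, hence is Lebesgue measure by uniqueness. *)
Lemma ge0_integral_affine (f : measurableTypeR R -> \bar R) (a b : R) : (0 < a)%R ->
  measurable_fun setT f -> (forall x, 0 <= f x) ->
  a%:E * \int[lambda]_t f (a * t + b)%R = \int[lambda]_t f t.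
Proof.
move=> a0 mf f0.
pose phi (t : measurableTypeR R) : measurableTypeR R := (a * t + b)%R.
have mphi : measurable_fun setT phi.
  by apply: measurable_funD => //; exact: measurable_funM.
pose a' : {nonneg R} := NngNum (ltW a0).
have := ge0_integral_pushforward mphi lambda measurableT mf (fun y _ => f0 y).
rewrite preimage_setT => <-.
rewrite -(ge0_integral_mscale _ measurableT a' mf)//.
apply: eq_measure_integral => A mA _; apply/esym.
apply: lebesgue_measure_unique => //.
move=> X [[c d] /= _ <-]; rewrite /mscale/= /pushforward.
rewrite (_ : phi @^-1` `]c, d]%classic =
    `]((c - b) / a)%R, ((d - b) / a)%R]%classic); last first.
  apply/seteqP; split => t /=; rewrite !in_itv/= ltr_pdivrMr// ler_pdivlMr//;
    by rewrite /phi ltrBlDr lerBrDr (mulrC t).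
rewrite !lebesgue_measure_itv/= !lte_fin ltr_pM2r ?invr_gt0// ltrD2r.
case: ifPn => _; last by rewrite mule0.
rewrite -EFinM; congr EFin.
by field; rewrite gt_eqF.
Qed.

Lemma measurable_affine n (a : R) (w : 'rV[R]_n) :
  measurable_fun setT (fun x : 'rV[R]_n => a *: x + w)%R.
Proof.
apply: measurable_rVP => i; under eq_fun do rewrite !mxE.
by apply: measurable_funD => //; apply: measurable_funM => //; exact: measurable_coord.
Qed.

Lemma ge0_integral_lebesgue_rV_affine n (f : 'rV[R]_n -> \bar R)
    (a : R) (w : 'rV[R]_n) : (0 < a)%R ->
  measurable_fun setT f -> (forall x, 0 <= f x) ->
  (a ^+ n)%:E * \int[lebesgue_rV n]_x f (a *: x + w)%R = \int[lebesgue_rV n]_x f x.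
Proof.
move=> a0; elim: n f w => [|n IH] f w mf f0.
  rewrite !integral_lebesgue_rV0//; last first.
    by apply: (measurableT_comp mf); exact: measurable_affine.
  by rewrite expr0 mul1e; congr f; apply/rowP => -[].
have mfa : measurable_fun setT (fun x : 'rV[R]_n.+1 => f (a *: x + w)%R).
  by apply: (measurableT_comp mf); exact: measurable_affine.
rewrite (integral_lebesgue_rVS mf f0) (integral_lebesgue_rVS mfa)//.
pose g t := \int[lebesgue_rV n]_y f (rV_cons (t, y)).
have mg : measurable_fun setT (g : measurableTypeR R -> _).
  exact: measurable_fun_lebesgue_rVS.
have g0 t : 0 <= g t by apply: integral_ge0.
rewrite -(ge0_integral_affine (w ord0 ord0) a0 mg g0).
rewrite exprS EFinM -muleA; congr (_ * _).
rewrite -ge0_integralZl//; last 3 first.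
- exact: (measurable_fun_lebesgue_rVS mfa).
- by move=> t _; exact: integral_ge0.
- by rewrite lee_fin exprn_ge0// ltW.
apply: eq_integral => t _; rewrite /g -[RHS](IH _ (rtail w))//; last first.
  exact: (@measurable_cons_section _ f _ mf).
congr (_ * _); apply: eq_integral => y _; congr f; apply/rowP => i.
rewrite !mxE; case: (unliftP ord0 i) => [j ->|->]; first by rewrite !mxE.
by [].
Qed.

Lemma lebesgue_rV_neq0 n c (A : set 'rV[R]_n) : measurable A ->
  (forall x : 'rV[R]_n, (forall i, c i <= x ord0 i <= c i + 1)%R -> A x) ->
  lebesgue_rV n A != 0.
Proof.
move=> mA cA; apply/negP => /eqP A0.
pose B := [set x : 'rV[R]_n | forall i, (x ord0 i \in `[c i, c i + 1])%R].
have mB : measurable B.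
  rewrite (_ : B = \bigcap_(i in [set: 'I_n])
      ((fun x : 'rV[R]_n => x ord0 i : measurableTypeR R) @^-1` `[c i, (c i + 1)%R]%classic)).
    apply: fin_bigcap_measurable => // i _.
    by rewrite -[X in measurable X]setTI; exact: measurable_coord.
  by apply/seteqP; split => [x h i _|x h i]; [exact: h|exact: (h i I)].
have : lebesgue_rV n B <= lebesgue_rV n A.
  have BA : B `<=` A by move=> x Bx; apply: cA => i; have := Bx i; rewrite in_itv.
  by apply: le_measure => //; rewrite inE.
rewrite A0 (_ : lebesgue_rV n B = 1); first by rewrite lee_fin ler10.
have := @lebesgue_rV_box R n c (fun i => c i + 1)%R; rewrite -/B => ->; last first.
  by move=> i; rewrite lerDl.
by congr EFin; apply: big1 => i _; rewrite addrAC subrr add0r.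
Qed.

Lemma measurable_gauss_density n P : measurable_fun setT (@gauss_density R n P).
Proof.
apply: measurable_funM => //; apply: (measurableT_comp (@measurable_expR R)).
apply: measurable_funN; apply: measurable_funM => //.
under eq_fun do rewrite sqr_enorm.
exact: measurable_dotvv.
Qed.

Lemma gauss_density_ge0 n (P : R) (x : 'rV[R]_n) : (0 <= gauss_density P x)%R.
Proof. by rewrite mulr_ge0// ?powR_ge0 ?expR_ge0. Qed.

Lemma gauss_density_gt0 n (P : R) (x : 'rV[R]_n) : (0 < P)%R -> (0 < gauss_density P x)%R.
Proof. by move=> P0; rewrite mulr_gt0// ?expR_gt0// powR_gt0// !mulr_gt0// pi_gt0. Qed.

Lemma gauss_density_cons n (P : R) t (y : 'rV[R]_n) : (0 < P)%R ->
  gauss_density P (rV_cons (t, y)) =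
  (normal_pdf 0 (Num.sqrt P) t * gauss_density P y)%R.
Proof.
move=> P0; have sP : Num.sqrt P != 0%R by rewrite sqrtr_eq0 -ltNge.
rewrite normal_pdfE// /normal_peak /normal_fun /gauss_density.
have tP : (0 < 2 * pi * P)%R by rewrite !mulr_gt0// pi_gt0.
rewrite !sqr_enorm sqr_sqrtr ?(ltW P0)// dotv_rtail rtail_cons rV_cons0/= subr0.
rewrite (_ : (P * pi *+ 2 = 2 * pi * P)%R); last by rewrite -mulr_natl; ring.
rewrite -powR12_sqrt ?(ltW tP)// -powRN mulrACA -powRD; last first.
  by rewrite (gt_eqF tP) implybT.
rewrite -expRD; congr (_ `^ _ * expR _)%R.
  by rewrite -natr1; field.
by rewrite expr2 -mulr_natl; field; rewrite gt_eqF.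
Qed.

Lemma integral_gauss_density n (P : R) : (0 < P)%R ->
  \int[lebesgue_rV n]_x (gauss_density P x)%:E = 1.
Proof.
move=> P0; elim: n => [|n IH].
  rewrite integral_lebesgue_rV0; last by apply/measurable_EFinP; exact: measurable_gauss_density.
  rewrite /gauss_density mul0r oppr0 powRr0 mul1r sqr_enorm dotvE big_ord0 mul0r.
  by rewrite oppr0 expR0.
rewrite integral_lebesgue_rVS//; last 2 first.
- by apply/measurable_EFinP; exact: measurable_gauss_density.
- by move=> x; rewrite lee_fin gauss_density_ge0.
rewrite -[RHS](integral_normal_pdf 0 (Num.sqrt P)); apply: eq_integral => t _.
under eq_integral do rewrite gauss_density_cons// EFinM.
rewrite ge0_integralZl//.
- by rewrite IH mule1.
- by apply/measurable_EFinP; exact: measurable_gauss_density.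
- by move=> x _; rewrite lee_fin gauss_density_ge0.
- by rewrite lee_fin normal_pdf_ge0.
Qed.

Lemma integrable_gauss_density n (P : R) D : (0 < P)%R -> measurable D ->
  (lebesgue_rV n).-integrable D (EFin \o gauss_density P).
Proof.
move=> P0 mD; apply: (@integrableS _ _ _ _ setT) => //.
apply/integrableP; split; first by apply/measurable_EFinP; exact: measurable_gauss_density.
under eq_integral do rewrite gee0_abs ?lee_fin ?gauss_density_ge0//=.
by rewrite integral_gauss_density// ltry.
Qed.

End lebesgue_rV_theory.

(** * Gaussian measure of dilated polyhedra *)

Section laplace_transform.
Context {R : realType} d {T : measurableType d}.
Variables (mu : {measure set T -> \bar R}) (D : set T) (g l : T -> R).
Hypotheses (mD : measurable D) (mg : measurable_fun D g) (ml : measurable_fun D l).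
Hypothesis g0 : forall y, 0 <= g y.
Hypothesis int_exp : forall t, mu.-integrable D (EFin \o (fun y => g y * expR (t * `|l y|))).

Lemma exprn_le_fact_expR k (x : R) : 0 <= x -> x ^+ k / k`!%:R <= expR x.
Proof.
elim: k x => [|k IH] x x0; first by rewrite expr0 fact0 divr1 -expR0 ler_expR.
pose f (y : R) : R := expR y + (-1) * ((y - 0) ^+ k.+1 / k.+1`!%:R).
have fd (y : R) : is_derive y 1 f (expR y + (-1) * ((y - 0) ^+ k / k`!%:R)).
  by apply: is_deriveD_fun; apply: is_deriveZ_fun; exact: is_derive_expn_shift.
have : f 0 <= f x.
  apply: (derive_ge0_le x0 (fun y _ => fd y)) => y /andP[y0 _].
  by rewrite subr0 mulN1r subr_ge0 IH.
rewrite /f !subr0 expr0n mul0r mulr0 addr0 expR0 mulN1r lerBrDr => h.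
by apply: le_trans h; rewrite lerDr.
Qed.

Definition laplace_term k (x : R) y := g y * ((- l y) ^+ k * expR (- (x * l y))).

(** Since |l|^k <= k! exp |l|, a derivative of any order k costs one unit in the exponent and the
    factor k! that [factorial_bound] allows. *)
Lemma laplace_term_bound k x B y : `|x| <= B ->
  `|laplace_term k x y| <= k`!%:R * (g y * expR ((B + 1) * `|l y|)).
Proof.
move=> xB; rewrite /laplace_term normrM (ger0_norm (g0 _)) mulrCA ler_wpM2l//.
rewrite normrM normrX normrN (ger0_norm (expR_ge0 _)).
rewrite addrC mulrDl mul1r expRD mulrA.
apply: ler_pM => //; rewrite ?expR_ge0 ?exprn_ge0//.
  by rewrite mulrC -ler_pdivrMr ?ltr0n ?fact_gt0// exprn_le_fact_expR.
by rewrite ler_expR (le_trans (ler_norm _))// normrN normrM ler_wpM2r.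
Qed.

Lemma measurable_laplace_term k x : measurable_fun D (laplace_term k x).
Proof.
apply: measurable_funM => //; apply: measurable_funM.
  by apply: measurable_funX; exact: measurable_funN.
apply: (measurableT_comp (@measurable_expR R)); apply: measurable_funN.
by apply: measurable_funM.
Qed.

Lemma integrable_laplace_bound k B : mu.-integrable D
  (EFin \o (fun y => k`!%:R * (g y * expR (B * `|l y|)))).
Proof. exact: (integrableZl mD k`!%:R (int_exp B)). Qed.

Lemma integrable_laplace_term k x : mu.-integrable D (EFin \o laplace_term k x).
Proof.
apply: le_integrable (integrable_laplace_bound k (`|x| + 1)) => //.
  by apply/measurable_EFinP; exact: measurable_laplace_term.
move=> y _; rewrite lee_fin /= [leRHS]ger0_norm; last first.
  by rewrite !mulr_ge0// expR_ge0.
exact: laplace_term_bound.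
Qed.

Definition laplace_seq k x := \int[mu]_(y in D) laplace_term k x y.

Lemma is_derive_laplace_term k (x : R) y :
  is_derive x 1 (fun x : R => laplace_term k x y) (laplace_term k.+1 x y).
Proof.
have d1 : is_derive x 1 (fun x : R => - (x * l y)) (- l y).
  have := is_deriveZ_fun (- l y) (is_derive_id x (1 : R)); rewrite mulr1.
  by under eq_fun do rewrite mulNr mulrC.
have d2 := is_derive1_comp (is_derive_expR _) d1.
have d3 := is_deriveZ_fun (g y) (is_deriveZ_fun ((- l y) ^+ k) d2).
apply: is_derive_eq d3 _.
by rewrite /laplace_term exprS; ring.
Qed.

Lemma laplace_deriv_seq : deriv_seq laplace_seq.
Proof.
move=> k a.
(* One unit bounds |x| on the window of radius 1 around a, the other pays for the powers of l. *)
pose G y := k.+1`!%:R * (g y * expR ((`|a| + 1 + 1) * `|l y|)).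
have Ia : (`]a - 1, a + 1[%classic : set R) a by rewrite /= in_itv/=; apply/andP; split; lra.
have dE x y : partial1of2 (laplace_term k) x y = laplace_term k.+1 x y.
  by rewrite partial1of2E; have := is_derive_laplace_term k x y => h; rewrite derive_val.
have G0 y : 0 <= G y by rewrite !mulr_ge0// expR_ge0.
have Gub x y : (`]a - 1, a + 1[%classic : set R) x -> D y ->
    `|partial1of2 (laplace_term k) x y| <= G y.
  rewrite /= in_itv/= => /andP[ax xa] _; rewrite dE; apply: laplace_term_bound.
  have -> : x = a + (x - a) by rewrite subrKC.
  by rewrite (le_trans (ler_normD _ _))// lerD2l ler_norml; apply/andP; split; lra.
have intf x : (`]a - 1, a + 1[%classic : set R) x ->
    mu.-integrable D (EFin \o laplace_term k x).
  by move=> _; exact: integrable_laplace_term.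
have der x y : (`]a - 1, a + 1[%classic : set R) x -> D y ->
    derivable (laplace_term k ^~ y) x 1.
  by move=> _ _; have := is_derive_laplace_term k x y => h; exact: ex_derive.
have intG : mu.-integrable D (EFin \o G) by exact: integrable_laplace_bound.
apply: DeriveDef.
  exact: (derivable_under_integral mD Ia intf der G0 intG Gub).
rewrite -derive1E (differentiation_under_integral mD Ia intf der G0 intG Gub).
by apply: eq_Rintegral => y _; exact: dE.
Qed.

Lemma entire_laplace : entire (fun x => \int[mu]_(y in D) (g y * expR (- (x * l y)))).
Proof.
exists laplace_seq; split; last first.
- move=> B.
  exists (\int[mu]_(y in D) (g y * expR ((B + 1) * `|l y|))), 1.
  split=> //.
    by apply: Rintegral_ge0 => y _; rewrite mulr_ge0// expR_ge0.
  move=> k x xB; rewrite expr1n mulr1 [leRHS]mulrC -RintegralZl//.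
  rewrite (le_trans (le_normr_Rintegral _ _))//; first exact: integrable_laplace_term.
  apply: le_Rintegral => //.
  - exact: integrable_norm (integrable_laplace_term k x).
  - exact: integrable_laplace_bound.
  - by move=> y _; exact: laplace_term_bound.
- exact: laplace_deriv_seq.
- apply/funext => x; apply: eq_Rintegral => y _.
  by rewrite /laplace_term expr0 mul1r.
Qed.

End laplace_transform.

(** * Gaussian integrals over translated cones *)

Section gaussian_transform.
Context {R : realType} {n : nat}.
Implicit Types (x w : 'rV[R]_n) (C : set 'rV[R]_n).
Local Notation mu := (@lebesgue_rV R n).

(** Half of the exponent |x|^2 / 2 absorbs the exponential factor; the other half is the exponent of
    the density of variance 2. *)
Lemma gauss_density_exp_le w (t : R) : exists2 K, 0 <= K & forall x,
  gauss_density 1 x * expR (t * `|dotv w x|) <= K * gauss_density 2 x.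
Proof.
have p0 (P : R) : 0 < P -> 0 < (2 * pi * P) `^ (- (n%:R / 2)) :> R.
  by move=> P0; rewrite powR_gt0// !mulr_gt0// pi_gt0.
pose c : R := (2 * pi * 1) `^ (- (n%:R / 2)) / (2 * pi * 2) `^ (- (n%:R / 2)).
have c0 : 0 < c by rewrite divr_gt0// p0.
exists (c * expR (t ^+ 2 * dotv w w)) => [|x]; first by rewrite mulr_ge0 ?expR_ge0 ?(ltW c0).
rewrite /gauss_density sqr_enorm -[leLHS]mulrA -expRD.
have -> : c * expR (t ^+ 2 * dotv w w) *
    ((2 * pi * 2) `^ (- (n%:R / 2)) * expR (- (dotv x x / (2 * 2)))) =
    (2 * pi * 1) `^ (- (n%:R / 2)) * expR (t ^+ 2 * dotv w w - dotv x x / (2 * 2)).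
  by rewrite expRD /c; field; rewrite gt_eqF// p0.
rewrite ler_wpM2l ?powR_ge0// ler_expR.
have cs := cauchy_schwarz_dotv w x.
have wx0 := dotv_ge0 w; have xx0 := dotv_ge0 x.
set u := `|dotv w x|; have u2 : u ^+ 2 <= dotv w w * dotv x x by rewrite real_normK ?num_real.
(* AM-GM for [t u <= t |w| |x|] *)
suff : t * u <= t ^+ 2 * dotv w w + dotv x x / 4 by move=> h; lra.
apply: le_trans (ler_norm _) _.
have rhs0 : 0 <= t ^+ 2 * dotv w w + dotv x x / 4.
  by apply: addr_ge0; [rewrite mulr_ge0// sqr_ge0|rewrite divr_ge0].
rewrite -(@ler_pXn2r _ 2)// ?nnegrE//.
rewrite real_normK ?num_real// exprMn.
apply: le_trans (_ : t ^+ 2 * (dotv w w * dotv x x) <= _); first by rewrite ler_wpM2l ?sqr_ge0.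
rewrite -subr_ge0 (_ : _ - _ = (t ^+ 2 * dotv w w - dotv x x / 4) ^+ 2); last by field.
exact: sqr_ge0.
Qed.

Lemma integrable_gauss_exp w (t : R) C : measurable C ->
  mu.-integrable C (EFin \o (fun x => gauss_density 1 x * expR (t * `|dotv w x|))).
Proof.
move=> mC; have [K K0 hK] := gauss_density_exp_le w t.
have i2 := integrableZl mC K (@integrable_gauss_density R n 2 C (ltr0Sn _ 1) mC).
apply: le_integrable i2 => //.
  apply/measurable_EFinP; apply: measurable_funTS; apply: measurable_funM.
    exact: measurable_gauss_density.
  apply: (measurableT_comp (@measurable_expR R)); apply: measurable_funM => //.
  by apply: measurableT_comp => //; exact: measurable_dotv.
move=> x _; rewrite lee_fin /= [leRHS]ger0_norm; last first.
  by rewrite (mulr_ge0 K0)// gauss_density_ge0.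
rewrite ger0_norm; first exact: hK.
by rewrite (mulr_ge0 (gauss_density_ge0 _ _))// expR_ge0.
Qed.

Lemma entire_gauss_laplace w C : measurable C ->
  entire (fun t => \int[mu]_(x in C) (gauss_density 1 x * expR (- (t * dotv w x)))).
Proof.
move=> mC; apply: (entire_laplace mC).
- by apply: measurable_funTS; exact: measurable_gauss_density.
- by apply: measurable_funTS; exact: measurable_dotv.
- by move=> y; exact: gauss_density_ge0.
- by move=> t; exact: integrable_gauss_exp.
Qed.

Lemma Rintegral_affine (f : 'rV[R]_n -> R) (a : R) w : 0 < a ->
  measurable_fun setT f -> (forall x, 0 <= f x) ->
  \int[mu]_x f x = a ^+ n * \int[mu]_x f (a *: x + w).
Proof.
move=> a0 mf f0; rewrite /Rintegral.
rewrite -(@ge0_integral_lebesgue_rV_affine R n (EFin \o f) a w a0); last 2 first.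
- by apply/measurable_EFinP.
- by move=> x; rewrite lee_fin.
have an : 0 < a ^+ n by rewrite exprn_gt0.
(* For an infinite integral both sides take the default real value 0. *)
rewrite /=; case: (\int[_]_x _)%E => [r||] //=.
  by rewrite mulry gtr0_sg// mul1e mulr0.
by rewrite mulrNy gtr0_sg// mul1e mulr0.
Qed.

Lemma gauss_density1D x w : gauss_density 1 (x + w) =
  expR (- (2^-1 * dotv w w)) * (gauss_density 1 x * expR (- dotv w x)).
Proof.
rewrite /gauss_density -(mulrA _ (expR _)) [RHS]mulrCA -!expRD; congr (_ * expR _).
by rewrite !sqr_enorm dotvDl !dotvDr (dotvC x w); field.
Qed.

Lemma cone_indic C t w x : cone C -> 0 < t -> \1_C (t^-1 *: x - w) = \1_C (x - t *: w) :> R.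
Proof.
move=> [_ Ct] t0; rewrite !indicE; congr (_%:R); congr nat_of_bool.
have e : t^-1 *: x - w = t^-1 *: (x - t *: w).
  by rewrite scalerBr scalerA mulVf ?gt_eqF// scale1r.
apply/idP/idP; rewrite !inE => h.
  by have := Ct _ _ t0 h; rewrite e scalerA divff ?gt_eqF// scale1r.
by rewrite e; apply: Ct => //; rewrite invr_gt0.
Qed.

(** The left side makes sense as a dilation only for t > 0; both factors on the right are entire in
    t. *)
Lemma gauss_cone C t w : cone C -> 0 < t ->
  \int[mu]_x (\1_C (t^-1 *: x - w) * gauss_density 1 x) =
  expR (- (2^-1 * dotv w w * t ^+ 2)) *
  \int[mu]_(x in C) (gauss_density 1 x * expR (- (t * dotv w x))).
Proof.
move=> Cc t0; have [mC _] := Cc.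
under eq_Rintegral do rewrite cone_indic//.
rewrite (@Rintegral_affine _ 1 (t *: w))//; last 2 first.
- apply: measurable_funM; last exact: measurable_gauss_density.
  apply: measurableT_comp; first exact: measurable_indic.
  under eq_fun do rewrite -[X in X - _]scale1r.
  exact: measurable_affine.
- by move=> x; rewrite mulr_ge0 ?gauss_density_ge0.
rewrite expr1n mul1r [in RHS]Rintegral_mkcond -RintegralZl//; last first.
  rewrite (_ : _ \o _ = ((EFin \o (fun x => gauss_density 1 x * expR (- (t * dotv w x)))) \_ C)).
    apply/(integrable_mkcond _ mC).
    apply: le_integrable (integrable_gauss_exp w `|t| mC) => //.
      apply/measurable_EFinP; apply: measurable_funTS; apply: measurable_funM.
        exact: measurable_gauss_density.
      apply: (measurableT_comp (@measurable_expR R)); apply: measurable_funN.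
      by apply: measurable_funM => //; exact: measurable_dotv.
    have ge0 x r : 0 <= gauss_density 1 x * expR r :> R.
      by rewrite (mulr_ge0 (gauss_density_ge0 _ _))// expR_ge0.
    move=> x _; rewrite lee_fin /= (ger0_norm (ge0 _ _)) (ger0_norm (ge0 _ _)).
    rewrite ler_wpM2l ?gauss_density_ge0// ler_expR -normrM (le_trans (ler_norm _))//.
    by rewrite normrN.
  by apply/funext => x; rewrite /= !patchE; case: ifP.
apply: eq_Rintegral => x _.
rewrite scale1r addrK gauss_density1D patchE indicE dotvZl dotvZr.
case: (x \in C); rewrite ?(mul0r, mulr0)// mul1r dotvZl; congr (expR _ * _).
by ring.
Qed.

End gaussian_transform.

Section gauss_cone_span.
Context {R : realType} {n : nat}.
Local Notation mu := (@lebesgue_rV R n).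

Lemma integrable_gauss_indic (C : set 'rV[R]_n) (c t : R) (w : 'rV[R]_n) :
  measurable C -> mu.-integrable setT
  (EFin \o (fun x => c * \1_C (t *: x - w) * gauss_density 1 x)).
Proof.
move=> mC; have g0 := @gauss_density_ge0 R n 1.
have := integrableZl measurableT `|c| (@integrable_gauss_density R n 1 setT ltr01 measurableT).
move=> h; apply: le_integrable h => //.
  apply/measurable_EFinP; apply: measurable_funM; last exact: measurable_gauss_density.
  apply: measurable_funM => //; apply: measurableT_comp; first exact: measurable_indic.
  exact: measurable_affine.
move=> x _; rewrite lee_fin /= [leRHS]ger0_norm; last by rewrite (mulr_ge0 _ (g0 _)).
rewrite normrM (ger0_norm (g0 _)) ler_wpM2r// normrM ler_piMr// indicE.
by case: (_ \in _); rewrite ?normr1 ?normr0.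
Qed.

(** Integrability travels along the induction because additivity of the real-valued integral relies
    on it. *)
Lemma gauss_cone_span (f : 'rV[R]_n -> R) : cone_span f ->
  (forall t, mu.-integrable setT (EFin \o (fun x => f (t *: x) * gauss_density 1 x))) /\
  exists2 g, entire g & forall t, 0 < t ->
    \int[mu]_x (f (t^-1 *: x) * gauss_density 1 x) = g t.
Proof.
elim=> [|c w C {}f Cc _ [fi [g ge gE]]].
  split=> [t|].
    rewrite (_ : _ \o _ = cst 0%E); last by apply/funext => x /=; rewrite mul0r.
    exact: integrable0.
  exists (fun=> 0) => [|t t0]; first exact: entire_cst.
  by under eq_Rintegral do rewrite mul0r; rewrite /Rintegral integral0.
have [mC _] := Cc.
have Di t x : (c * \1_C (t *: x - w) + f (t *: x)) * gauss_density 1 x =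
  c * \1_C (t *: x - w) * gauss_density 1 x + f (t *: x) * gauss_density 1 x.
  by rewrite mulrDl.
split=> [t|].
  rewrite (_ : _ \o _ = ((EFin \o (fun x : 'rV[R]_n => c * \1_C (t *: x - w) * gauss_density 1 x)%R) \+
     (EFin \o (fun x : 'rV[R]_n => f (t *: x) * gauss_density 1 x)%R))%E); last first.
    by apply/funext => x /=; rewrite Di.
  by apply: integrableD => //; exact: integrable_gauss_indic.
exists (fun t => c * (expR (- (2^-1 * dotv w w * t ^+ 2)) *
  \int[mu]_(x in C) (gauss_density 1 x * expR (- (t * dotv w x)))) + g t).
  apply: entireD => //; apply: entireZ; apply: entireM.
    by apply: entire_gauss; rewrite mulr_ge0 ?invr_ge0// dotv_ge0.
  exact: entire_gauss_laplace.
move=> t t0; under eq_Rintegral do rewrite Di.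
rewrite RintegralD//; last exact: integrable_gauss_indic.
rewrite gE//; congr (_ + _).
under eq_Rintegral do rewrite -mulrA.
rewrite RintegralZl ?gauss_cone//.
have := @integrable_gauss_indic C 1 t^-1 w mC.
by congr integrable; apply/funext => x /=; rewrite mul1r.
Qed.

End gauss_cone_span.

(** * The error rate as an entire function of P^(-1/2) *)

Section symbol_error_rate.
Context {R : realType} {n M : nat}.
Variables (s : 'I_M -> 'rV[R]_n).
Local Notation Omega := (decision_region s).

Lemma measurable_decision_region i : measurable (Omega i).
Proof.
rewrite (_ : Omega i = \bigcap_(j in [set j | j != i])
    ((fun x => dotv (unit_dir s i j) x : measurableTypeR R) @^-1`
       `]-oo, half_dist s i j]%classic)).
  apply: fin_bigcap_measurable => [|j _]; first exact: (@sub_finite_set _ _ [set: 'I_M]).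
  by rewrite -[X in measurable X]setTI; exact: measurable_dotv.
apply/seteqP; split => [x h j ji|x h j ji].
  by rewrite /= in_itv/=; apply: h.
by have := h _ ji; rewrite /= in_itv.
Qed.

Lemma polyfun_decision_region i : polyfun (\1_(Omega i) : 'rV[R]_n -> R).
Proof.
rewrite (_ : \1_(Omega i) = fun x => \prod_(j <- index_enum 'I_M | j != i)
   (dotv (unit_dir s i j) x <= half_dist s i j)%R%:R).
  elim: (index_enum _) => [|j r IH].
    by under eq_fun do rewrite big_nil; exact: polyfun_cst.
  under eq_fun do rewrite big_cons.
  by case: (j != i) => //; apply: polyfunM => //; exact: polyfun_half.
apply/funext => x; rewrite indicE; case: (boolP (x \in Omega i)) => [|].
  by rewrite inE => h; rewrite big1// => j ji; rewrite h.
rewrite notin_setE => /existsNP[j] /not_implyP[ji] /negP h.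
by rewrite (bigD1 j)//= (negbTE h) mul0r.
Qed.

Lemma Pc_at_scale i (P : R) : 0 < P -> Pc_at s i P =
  \int[lebesgue_rV n]_x (\1_(Omega i) (Num.sqrt P *: x) * gauss_density 1 x).
Proof.
move=> P0; have sP : 0 < Num.sqrt P by rewrite sqrtr_gt0.
have mO := measurable_decision_region i.
rewrite /Pc_at Rintegral_mkcond (@Rintegral_affine _ _ _ (Num.sqrt P) 0)//; last 2 first.
- apply/(measurable_restrictT _ mO); apply: measurable_funTS.
  exact: measurable_gauss_density.
- by move=> x; rewrite patchE; case: ifP => // _; exact: gauss_density_ge0.
have tP : 0 < 2 * pi * P by rewrite !mulr_gt0// pi_gt0.
(* The Jacobian of the dilation cancels the factor P^(-n/2) of the density. *)
have key (x : 'rV[R]_n) : Num.sqrt P ^+ n * gauss_density P (Num.sqrt P *: x) = gauss_density 1 x.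
  rewrite /gauss_density !sqr_enorm dotvZl dotvZr mulrA -expr2 sqr_sqrtr ?(ltW P0)//.
  rewrite mulrA; congr (_ * expR _); last by field; rewrite gt_eqF.
  have -> : 2 * pi * P = 2 * pi * 1 * P :> R by ring.
  rewrite [in LHS]powRM ?(ltW P0)//; last by rewrite mulr1 mulr_ge0// pi_ge0.
  rewrite mulrCA -[RHS]mulr1; congr (_ * _).
  rewrite -powR12_sqrt ?(ltW P0)// -powR_mulrn ?powR_ge0// -powRrM -powRD; last first.
    by rewrite (gt_eqF P0) implybT.
  have n2 (a : R) : 2^-1 * a - a / 2 = 0 by ring.
  by rewrite n2 powRr0.
rewrite -RintegralZl//; last first.
  have i1 := @integrable_gauss_indic R n _ (Num.sqrt P ^- n) (Num.sqrt P) 0 mO.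
  move: i1; congr integrable; apply/funext => x /=; rewrite patchE indicE addr0 subr0 -key.
  by case: (_ \in _); rewrite ?mulr0 ?mul0r// mulr1 mulKf// gt_eqF// exprn_gt0.
apply: eq_Rintegral => x _; rewrite addr0 patchE indicE.
by case: (_ \in _); rewrite ?mulr0 ?mul0r// mul1r key.
Qed.

Lemma Pc_at_entire i : exists2 g, entire g &
  forall P, 0 < P -> Pc_at s i P = g (Num.sqrt P)^-1.
Proof.
have [_ [g ge gE]] := gauss_cone_span (polyfun_cone_span (polyfun_decision_region i)).
exists g => // P P0; rewrite -gE ?invr_gt0 ?sqrtr_gt0// invrK.
exact: Pc_at_scale.
Qed.

Lemma Pe_entire prior : exists F, [/\ deriv_seq F, factorial_bound F &
  forall P, 0 < P -> Pe s prior P = F 0%N (Num.sqrt P)^-1].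
Proof.
have /choice[g gP] i : exists g, entire g /\
    forall P, 0 < P -> Pc_at s i P = g (Num.sqrt P)^-1.
  by have [g ? ?] := Pc_at_entire i; exists g.
have : entire (fun t => \sum_i (1 + (-1) * g i t) * prior i).
  apply: entire_sum => i; apply: entireM; last exact: entire_cst.
  apply: entireD; first exact: entire_cst.
  by apply: entireZ; have [] := gP i.
move=> [F [F0 FE FB]]; exists F; split=> // P P0; rewrite F0.
by apply: eq_bigr => i _; rewrite /Pe_at mulN1r; have [_ ->] := gP i.
Qed.

End symbol_error_rate.

(** * Convexity in the noise power *)

Section convexity.
Context {R : realType}.
Implicit Types (D : set R) (f : R -> R).

Lemma convex_onP D f : (forall a b t, D a -> D b -> a < b -> 0 < t < 1 ->
    f (t * a + (1 - t) * b) <= t * f a + (1 - t) * f b) -> convex_on D f.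
Proof.
move=> fc t a b; rewrite !inE => Da Db; rewrite convRE.
rewrite [X in f X](convRE a b t : _ = t%:num * a + (1 - t%:num) * b).
have [t0|t0] := eqVneq (t%:num : R) 0; first by rewrite t0 /unstable.onem subr0 !mul0r !add0r !mul1r.
have [t1|t1] := eqVneq (t%:num : R) 1; first by rewrite t1 /unstable.onem subrr !mul0r !addr0 !mul1r.
have t01 : 0 < (t%:num : R) < 1.
  by apply/andP; split; [rewrite lt_def t0/=|rewrite lt_neqAle t1/=].
rewrite /unstable.onem; case: (ltgtP a b) => [ab|ba|<-].
- exact: fc.
- rewrite addrC [leRHS]addrC; have := fc b a (1 - t%:num) Db Da ba; rewrite subKr.
  by apply; move/andP: t01 => [? ?]; apply/andP; split; lra.
- by rewrite -!mulrDl subrKC !mul1r.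
Qed.

End convexity.

(** * Convexity of the Gaussian density in its variance *)

Section gauss_density_convexity.
Context {R : realType} {n : nat}.
Implicit Types (x : 'rV[R]_n) (P : R).

Definition gauss_log_deriv x P : R := dotv x x / 2 * P ^- 2 - n%:R / 2 * P^-1.

Lemma is_derive_inv P : 0 < P -> is_derive P 1 (fun P : R => P^-1) (- P ^- 2).
Proof.
move=> P0; have := @is_deriveV R id P 1 1 (lt0r_neq0 P0) (is_derive_id P 1).
by move=> h; apply: is_derive_eq h _; rewrite /GRing.scale/= mulr1.
Qed.

Lemma is_derive_inv2 P : 0 < P -> is_derive P 1 (fun P : R => P ^- 2) (- 2 * P ^- 3).
Proof.
move=> P0; have P0' := lt0r_neq0 P0.
have := @is_deriveV R (fun P => P * P) P _ 1 (mulf_neq0 P0' P0')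
  (is_deriveM_fun (is_derive_id P 1) (is_derive_id P 1)).
by move=> h; apply: is_derive_eq h _; rewrite /GRing.scale/=; field.
Qed.

Lemma is_derive_gauss_density x P : 0 < P ->
  is_derive P 1 (fun P => gauss_density P x) (gauss_density P x * gauss_log_deriv x P).
Proof.
move=> P0; have c0 : 0 < 2 * pi :> R by rewrite mulr_gt0// pi_gt0.
have cP : 0 < 2 * pi * P by rewrite mulr_gt0.
have d1 : is_derive P 1 (fun P => 2 * pi * P) (2 * pi).
  by have := is_deriveZ_fun (2 * pi) (is_derive_id P (1 : R)); rewrite mulr1.
have d2 := is_derive1_comp (is_derive1_powR (- (n%:R / 2)) cP) d1.
have d3 := is_deriveZ_fun (- (dotv x x / 2)) (is_derive_inv P0).
have d4 := is_derive1_comp (is_derive_expR _) d3.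
have d5 := is_deriveM_fun d2 d4.
rewrite (_ : (fun P => gauss_density P x) = (fun y : R =>
    (2 * pi * y) `^ (- (n%:R / 2)) * expR (- (dotv x x / 2) * y^-1))); last first.
  apply/funext => y; rewrite /gauss_density sqr_enorm; congr (_ * expR _).
  by rewrite invfM mulrA mulNr.
apply: is_derive_eq d5 _; rewrite /gauss_density sqr_enorm /gauss_log_deriv /=.
rewrite powRB ?(gt_eqF cP) ?implybT// powRr1 ?(ltW cP)//.
have -> : - (dotv x x / (2 * P)) = - (dotv x x / 2) * P^-1 by rewrite invfM mulrA mulNr.
have := pi_gt0 R; move: (@pi R) => p p0; by field; rewrite !gt_eqF.
Qed.

(** The second derivative of the density in P, divided by the density and multiplied by 4 P^4. As a
    difference of squares it vanishes at |x|^2 = (n + 2 +- sqrt (2 (n + 2))) P, the origin of the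
    two thresholds. *)
Definition gauss_convexity x P : R :=
  (dotv x x - (n%:R + 2) * P) ^+ 2 - 2 * (n%:R + 2) * P ^+ 2.

Lemma is_derive_gauss_density2 x P : 0 < P ->
  is_derive P 1 (fun P => gauss_density P x * gauss_log_deriv x P)
    (gauss_density P x * (gauss_convexity x P / (4 * P ^+ 4))).
Proof.
move=> P0; have := is_deriveM_fun (is_derive_gauss_density x P0)
  (is_deriveD_fun (is_deriveZ_fun (dotv x x / 2) (is_derive_inv2 P0))
     (is_deriveZ_fun (- (n%:R / 2)) (is_derive_inv P0))).
rewrite (_ : (fun y => _) = (fun P => gauss_density P x * gauss_log_deriv x P)); last first.
  by apply/funext => y; rewrite /gauss_log_deriv mulNr.
move=> h; apply: is_derive_eq h _; rewrite /gauss_log_deriv /gauss_convexity.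
by field; rewrite gt_eqF.
Qed.

Lemma gauss_density_convex x a b t : 0 < a -> a < b -> 0 < t < 1 ->
  (forall P, a <= P <= b -> 0 <= gauss_convexity x P) ->
  gauss_density (t * a + (1 - t) * b) x <=
  t * gauss_density a x + (1 - t) * gauss_density b x.
Proof.
move=> a0 ab t01 qP.
have pos P : a <= P <= b -> 0 < P by move=> /andP[aP _]; exact: lt_le_trans aP.
apply: (@derive2_ge0_convex _ (fun P => gauss_density P x)
  (fun P => gauss_density P x * gauss_log_deriv x P)
  (fun P => gauss_density P x * (gauss_convexity x P / (4 * P ^+ 4)))
  a b t ab t01) => P Pab.
- exact: is_derive_gauss_density (pos _ Pab).
- exact: is_derive_gauss_density2 (pos _ Pab).
- apply: mulr_ge0; first exact: gauss_density_ge0.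
  by rewrite divr_ge0 ?qP// mulr_ge0// exprn_ge0// ltW// pos.
Qed.

Lemma Rintegral_gauss_density_convex (D : set 'rV[R]_n) a b t :
  measurable D -> 0 < a -> a < b -> 0 < t < 1 ->
  (forall x P, D x -> a <= P <= b -> 0 <= gauss_convexity x P) ->
  \int[lebesgue_rV n]_(x in D) gauss_density (t * a + (1 - t) * b) x <=
  t * \int[lebesgue_rV n]_(x in D) gauss_density a x +
  (1 - t) * \int[lebesgue_rV n]_(x in D) gauss_density b x.
Proof.
move=> mD a0 ab t01 hD; have /andP[t0 t1] := t01.
have b0 : 0 < b by exact: lt_trans ab.
have z0 : 0 < t * a + (1 - t) * b by rewrite addr_gt0// mulr_gt0// subr_gt0.
have ia := integrable_gauss_density a0 mD; have ib := integrable_gauss_density b0 mD.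
have iz := integrable_gauss_density z0 mD.
have iza := integrableZl mD t ia; have izb := integrableZl mD (1 - t) ib.
rewrite -!RintegralZl// -RintegralD//.
apply: le_Rintegral => //; first exact: (integrableD mD iza izb).
by move=> x Dx; apply: gauss_density_convex => // P; exact: hD.
Qed.

Lemma gauss_convexity_small x P : 0 < P ->
  dotv x x <= (n%:R + 2 - Num.sqrt (2 * (n%:R + 2))) * P -> 0 <= gauss_convexity x P.
Proof.
move=> P0 h; rewrite /gauss_convexity; set r := Num.sqrt _ in h.
have r0 : 0 <= r by exact: sqrtr_ge0.
have <- : r ^+ 2 = 2 * (n%:R + 2) by rewrite sqr_sqrtr// mulr_ge0// addr_ge0.
have rP : 0 <= r * P by rewrite mulr_ge0// ltW.
rewrite -exprMn subr_sqr mulr_le0//; rewrite mulrBl in h; lra.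
Qed.

Lemma gauss_convexity_large x P : 0 < P ->
  (n%:R + 2 + Num.sqrt (2 * (n%:R + 2))) * P <= dotv x x -> 0 <= gauss_convexity x P.
Proof.
move=> P0 h; rewrite /gauss_convexity; set r := Num.sqrt _ in h.
have r0 : 0 <= r by exact: sqrtr_ge0.
have <- : r ^+ 2 = 2 * (n%:R + 2) by rewrite sqr_sqrtr// mulr_ge0// addr_ge0.
have rP : 0 <= r * P by rewrite mulr_ge0// ltW.
rewrite -exprMn subr_sqr mulr_ge0//; rewrite mulrDl in h; lra.
Qed.

End gauss_density_convexity.

(** * Geometry of the decision regions *)

Section constellation_geometry.
Context {R : realType} {n M : nat}.
Variable s : 'I_M -> 'rV[R]_n.
Hypotheses (hn : (1 <= n)%N) (hM : (2 <= M)%N) (hs : injective s).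
Local Notation Omega := (decision_region s).
Local Notation cplus := (n%:R + 2 + Num.sqrt (2 * (n%:R + 2)) : R).
Local Notation cminus := (n%:R + 2 - Num.sqrt (2 * (n%:R + 2)) : R).

Lemma half_dist_gt0 i j : j != i -> 0 < half_dist s i j.
Proof.
move=> ji; rewrite divr_gt0// lt_def enorm_ge0 andbT enorm_eq0 subr_eq0.
by apply: contra ji => /eqP/hs->.
Qed.

Lemma dotv_unit_dir i j : j != i -> dotv (unit_dir s i j) (unit_dir s i j) = 1.
Proof.
move=> ji; have h := half_dist_gt0 ji; rewrite dotvZl dotvZr -sqr_enorm; field.
by rewrite gt_eqF//; rewrite /half_dist in h; lra.
Qed.

Lemma exists_other i : exists j : 'I_M, j != i.
Proof.
have M0 : (0 < M)%N by exact: ltn_trans hM.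
have [->|i0] := eqVneq i (Ordinal M0); first by exists (Ordinal hM).
by exists (Ordinal M0); rewrite eq_sym.
Qed.

Lemma dmin_spec : exists d, [/\ 0 < d, dmin s = d%:E &
  forall i j, j != i -> d <= half_dist s i j].
Proof.
have dle i j : j != i -> (dmin s <= (half_dist s i j)%:E)%E.
  move=> ji; apply: (@le_trans _ _ (dmin_at s i)); first exact: bigmin_le_cond.
  exact: (@bigmin_le_cond _ _ _ +oo%E j (fun j => j != i)
    (fun j => (half_dist s i j)%:E) ji).
have d0 : (0 < dmin s)%E.
  apply: lt_bigmin => // i _; apply: lt_bigmin => // j ji.
  by rewrite lte_fin half_dist_gt0.
have i0 : 'I_M by exact: (Ordinal (ltn_trans (ltnSn 0) hM)).
have [j0 j0i] := exists_other i0.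
move: d0 dle; case: (dmin s) => [d||//] d0 dle; last first.
  by have := dle _ _ j0i; rewrite leye_eq.
by exists d; split.
Qed.

Lemma notin_decision_region d i x : (forall i j, j != i -> d <= half_dist s i j) ->
  0 < d -> ~ Omega i x -> d ^+ 2 <= dotv x x.
Proof.
move=> hd d0 /existsNP[j] /not_implyP[ji] /negP; rewrite -ltNge => h.
have := cauchy_schwarz_dotv (unit_dir s i j) x; rewrite dotv_unit_dir// mul1r.
apply: le_trans; have := hd _ _ ji => hij.
have dx : d <= dotv (unit_dir s i j) x by rewrite (le_trans hij)// ltW.
by rewrite lerXn2r ?nnegrE ?(ltW d0)// (le_trans (ltW d0)).
Qed.

Lemma cplus_gt0 : 0 < cplus.
Proof. by rewrite ltr_pwDl ?sqrtr_ge0// ltr_wpDl. Qed.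

Lemma cminus_gt0 : 0 < cminus.
Proof.
have n2 : 0 < n%:R + 2 :> R by rewrite ltr_wpDl.
rewrite subr_gt0 -[ltRHS]gtr0_norm// -sqrtr_sqr ltr_sqrt ?exprn_gt0//.
by rewrite expr2 ltr_pM2r// ltrDr ltr0n.
Qed.

(** The ray along u leaves the region at its largest admissible multiple, which exists by
    boundedness and still satisfies every closed inequality. It is not interior, or a slightly
    larger multiple would be admissible. *)
Lemma decision_region_boundary i (u : 'rV[R]_n) t : bounded_set (Omega i) -> u != 0 ->
  0 <= t -> Omega i (t *: u) -> exists2 r, t <= r & boundary (Omega i) (r *: u).
Proof.
move=> [N [_ hN]] u0 t0 Ot.
have nu : 0 < `|u| by rewrite normr_gt0.
pose T := [set r : R | 0 <= r /\ Omega i (r *: u)].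
have Tt : T t by [].
have hT : has_sup T.
  split; first by exists t.
  exists ((N + 1) / `|u|) => r [r0 Or]; rewrite ler_pdivlMr//.
  have := hN (N + 1) (ltr_pwDr ltr01 (lexx _)) _ Or.
  by rewrite /= normrZ ger0_norm.
have tr : t <= sup T by exact: sup_upper_bound.
exists (sup T) => //.
have r0 : 0 <= sup T by exact: le_trans tr.
split.
  apply: subset_closure => j ji; rewrite dotvZr.
  have b0 := half_dist_gt0 ji.
  have [c0|c0] := leP (dotv (unit_dir s i j) u) 0.
    by apply: le_trans (ltW b0); rewrite mulr_ge0_le0.
  rewrite -ler_pdivlMr//; apply: sup_le_ub; first by exists t.
  move=> r [_ Or]; rewrite ler_pdivlMr//.
  by have := Or _ ji; rewrite dotvZr.
move=> Oi.
have cu : {for sup T, continuous (fun r : R => r *: u)} by exact: scalel_continuous.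
have /nbhs_ballP[e /= e0 he] := cu _ Oi.
have : T (sup T + e / 2).
  split; first by rewrite addr_ge0// divr_ge0// ltW.
  apply: he; rewrite /ball/= opprD addrA subrr sub0r normrN ger0_norm ?divr_ge0 ?(ltW e0)//.
  by lra.
move=> /(sup_upper_bound hT); rewrite gerDl; lra.
Qed.

Lemma enorm_le_dmax i x : Omega i x -> ((enorm x)%:E <= dmax s)%E.
Proof.
move=> Ox; apply: (@le_trans _ _ (dmax_at s i)); last exact: le_bigmax_cond.
rewrite /dmax_at; case: asboolP => bd; last by rewrite leey.
have key (u : 'rV[R]_n) t : u != 0 -> 0 <= t -> Omega i (t *: u) ->
    ((t * enorm u)%:E <= ereal_sup [set (enorm x)%:E | x in boundary (Omega i)])%E.
  move=> u0 t0 Ot; have [r tr br] := decision_region_boundary bd u0 t0 Ot.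
  apply: (@le_trans _ _ (enorm (r *: u))%:E); last by apply: ereal_sup_ubound; exists (r *: u).
  by rewrite lee_fin enormZ ler_wpM2r ?enorm_ge0// (le_trans tr)// ler_norm.
have [x0|x0] := eqVneq x 0; last by have := @key x 1 x0; rewrite mul1r scale1r; apply.
(* At the origin no direction is given, and any nonzero vector, available as n >= 1, leads to a
   boundary point. *)
have u0 : (const_mx 1 : 'rV[R]_n) != 0.
  apply/eqP => /rowP/(_ (Ordinal hn)); rewrite !mxE => /eqP.
  by rewrite oner_eq0.
have := key _ 0 u0; rewrite mul0r scale0r.
have /eqP -> : enorm x == 0 by rewrite enorm_eq0 x0.
by apply => //; rewrite -x0.
Qed.

Lemma high_noise_region i x P : (high_noise_bound s <= P%:E)%E -> Omega i x ->
  dotv x x <= cminus * P.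
Proof.
move=> hP /enorm_le_dmax; move: hP; rewrite /high_noise_bound.
case: (dmax s) => [D||]; last by rewrite leeNy_eq.
- rewrite -EFin_expe -EFinM !lee_fin ler_pdivrMr ?cminus_gt0// => DP xD.
  rewrite mulrC (le_trans _ DP)// -sqr_enorm lerXn2r// ?nnegrE ?enorm_ge0//.
  exact: le_trans (enorm_ge0 _) xD.
(* An infinite [dmax] makes the threshold infinite, because [cminus] is positive; no real P lies
   above it. *)
- by rewrite expe2 mulyy gt0_mulye ?lte_fin ?invr_gt0 ?cminus_gt0// leye_eq.
Qed.

Lemma low_noise_boundE d : dmin s = d%:E -> low_noise_bound s = (d ^+ 2 / cplus)%:E.
Proof. by move=> dE; rewrite /low_noise_bound dE -EFin_expe -EFinM. Qed.

Lemma low_noise_region i x P : (P%:E <= low_noise_bound s)%E -> ~ Omega i x ->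
  cplus * P <= dotv x x.
Proof.
have [d [d0 dE hd]] := dmin_spec.
rewrite (low_noise_boundE dE) lee_fin ler_pdivlMr ?cplus_gt0// => hP.
by move=> /(notin_decision_region hd d0); apply: le_trans; rewrite mulrC.
Qed.

Lemma low_noise_bound_gt0 : exists2 P, 0 < P & low_noise_bound s = P%:E.
Proof.
have [d [d0 dE _]] := dmin_spec; exists (d ^+ 2 / cplus).
  by rewrite divr_gt0 ?exprn_gt0 ?cplus_gt0.
exact: low_noise_boundE.
Qed.

End constellation_geometry.

(** * Convexity, concavity and nonconstancy of the error rate *)

Section noise_convexity.
Context {R : realType} {n M : nat}.
Variables (s : 'I_M -> 'rV[R]_n) (prior : 'I_M -> R).
Hypotheses (hn : (1 <= n)%N) (hM : (2 <= M)%N) (hs : injective s).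
Hypothesis hprior : is_prior prior.
Local Notation Omega := (decision_region s).

Lemma Pe_atE i P : 0 < P -> Pe_at s i P =
  \int[lebesgue_rV n]_(x in ~` Omega i) gauss_density P x.
Proof.
move=> P0; have mO := measurable_decision_region s i.
have := @Rintegral_setU _ _ _ (lebesgue_rV n) (Omega i) (~` Omega i) (gauss_density P).
rewrite setUv => /(_ mO (measurableC mO) (integrable_gauss_density P0 measurableT)).
rewrite /disj_set setICr eqxx => /(_ isT) e.
have e1 : \int[lebesgue_rV n]_x gauss_density P x = 1.
  by rewrite /Rintegral integral_gauss_density.
by rewrite /Pe_at /Pc_at; move: e; rewrite e1; lra.
Qed.

Lemma Pe_convex_low (a b t : R) : 0 < a -> (b%:E <= low_noise_bound s)%E ->
  a < b -> 0 < t < 1 ->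
  Pe s prior (t * a + (1 - t) * b) <= t * Pe s prior a + (1 - t) * Pe s prior b.
Proof.
move=> a0 bl ab t01; have b0 := lt_trans a0 ab; have [t0 t1] := andP t01.
have z0 : 0 < t * a + (1 - t) * b by rewrite addr_gt0// mulr_gt0// subr_gt0.
rewrite /Pe !mulr_sumr -big_split/=; apply: ler_sum => i _.
rewrite !mulrA -mulrDl ler_wpM2r ?hprior.1//.
have mO := measurableC (measurable_decision_region s i).
rewrite !Pe_atE//; apply: Rintegral_gauss_density_convex => // x P Ox /andP[aP Pb].
apply: gauss_convexity_large; first exact: lt_le_trans aP.
have bx := low_noise_region hM hs bl Ox.
by apply: le_trans bx; rewrite ler_wpM2l// ltW// cplus_gt0.
Qed.

Lemma Pe_concave_high (a b t : R) : 0 < a -> (high_noise_bound s <= a%:E)%E ->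
  a < b -> 0 < t < 1 ->
  t * Pe s prior a + (1 - t) * Pe s prior b <= Pe s prior (t * a + (1 - t) * b).
Proof.
move=> a0 ha ab t01; have b0 := lt_trans a0 ab; have [t0 t1] := andP t01.
have z0 : 0 < t * a + (1 - t) * b by rewrite addr_gt0// mulr_gt0// subr_gt0.
rewrite /Pe !mulr_sumr -big_split/=; apply: ler_sum => i _.
rewrite !mulrA -mulrDl ler_wpM2r ?hprior.1// /Pe_at.
have mO := measurable_decision_region s i.
suff : Pc_at s i (t * a + (1 - t) * b) <= t * Pc_at s i a + (1 - t) * Pc_at s i b.
  by move: (Pc_at _ _ _) (Pc_at _ _ _) (Pc_at _ _ _) => u v w h; lra.
apply: Rintegral_gauss_density_convex => // x P Ox /andP[aP Pb].
have P0 := lt_le_trans a0 aP; apply: gauss_convexity_small => //.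
apply: (high_noise_region hn hs _ Ox).
by rewrite (le_trans ha)// lee_fin.
Qed.

(* Below [dmin^2 / n] the density increases with the noise power off the
   decision regions. *)
Lemma Pe_not_constant : exists a b, [/\ 0 < a, 0 < b & Pe s prior a != Pe s prior b].
Proof.
have [d [d0 dE hd]] := dmin_spec hM hs.
pose b := d ^+ 2 / (n%:R + 1); have n1 : 0 < n%:R + 1 :> R by rewrite ltr_wpDl.
have b0 : 0 < b by rewrite divr_gt0// exprn_gt0.
pose a := b / 2; have a0 : 0 < a by rewrite divr_gt0.
have ab : a < b by rewrite /a; lra.
have incr i x : ~ Omega i x -> gauss_density a x < gauss_density b x.
  move=> Ox; have dx := notin_decision_region hs hd d0 Ox.
  have [c /andP[ac cb] e] : exists2 c, a < c < b & gauss_density b x - gauss_density a x =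
      gauss_density c x * gauss_log_deriv x c * (b - a).
    apply: (@mean_value _ (fun P => gauss_density P x)
      (fun P => gauss_density P x * gauss_log_deriv x P) a b ab) => P /andP[aP _].
    by apply: is_derive_gauss_density; exact: lt_le_trans aP.
  have c0 := lt_trans a0 ac.
  rewrite -subr_gt0 e mulr_gt0 ?subr_gt0// mulr_gt0 ?gauss_density_gt0//.
  have -> : gauss_log_deriv x c = (dotv x x - n%:R * c) / 2 * c ^- 2.
    by rewrite /gauss_log_deriv; field; rewrite gt_eqF.
  rewrite mulr_gt0 ?invr_gt0 ?exprn_gt0// divr_gt0// subr_gt0.
  apply: lt_le_trans dx; rewrite -(@divfK _ (n%:R + 1) _ (d ^+ 2)) ?gt_eqF// -/b.
  rewrite mulrC; apply: le_lt_trans (_ : c * (n%:R + 1) < _).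
    by rewrite ler_wpM2l ?(ltW c0)// lerDl.
  by rewrite ltr_pM2r.
clearbody a b.
have lt_at i : Pe_at s i a < Pe_at s i b.
  have mO := measurableC (measurable_decision_region s i).
  have ia := integrable_gauss_density a0 mO; have ib := integrable_gauss_density b0 mO.
  have le_ab : Pe_at s i a <= Pe_at s i b.
    by rewrite (Pe_atE _ a0) (Pe_atE _ b0); apply: le_Rintegral => // x /incr/ltW.
  (* Equality would give a positive function the integral 0 over the complement of the region, which
     would then be a null set; but this complement contains a unit cube. *)
  rewrite lt_neqAle le_ab andbT; apply/negP => /eqP eab.
  have iB : (lebesgue_rV n).-integrable (~` Omega i)
      (EFin \o (fun x => gauss_density b x - gauss_density a x)) by exact: (integrableB mO ib ia).
  have I0 : (\int[lebesgue_rV n]_(x in ~` Omega i)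
      `|(gauss_density b x - gauss_density a x)%:E|)%E = 0%E.
    have -> : (\int[lebesgue_rV n]_(x in ~` Omega i)
        `|(gauss_density b x - gauss_density a x)%:E|)%E =
      (\int[lebesgue_rV n]_(x in ~` Omega i) (gauss_density b x - gauss_density a x)%:E)%E.
      apply: eq_integral => x; rewrite inE => /incr h.
      by rewrite gee0_abs// lee_fin subr_ge0 ltW.
    rewrite -(fineK (integrable_fin_num mO iB)) -/(Rintegral _ _ _) RintegralB//.
    by rewrite -!Pe_atE// eab subrr.
  have mB : measurable_fun (~` Omega i) (fun x => (gauss_density b x - gauss_density a x)%:E).
    exact: measurable_int iB.
  have [/(_ I0) ae0 _] := ae_eq_integral_abs (lebesgue_rV n) mO mB.
  have O0 : lebesgue_rV n (~` Omega i) = 0%E.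
    case: ae0 => N [mN N0 hN]; apply/eqP; rewrite eq_le measure_ge0 andbT -N0.
    apply: le_measure; rewrite ?inE// => x Ox; apply: hN => /(_ Ox) /= [] /eqP.
    by rewrite subr_eq0 gt_eqF// (incr _ _ Ox).
  have [j ji] := exists_other hM i; pose u := unit_dir s i j.
  (* Inside the unit cube with corner L u the inner product with u differs from L by at most A, so
     this L puts the cube beyond the face facing s j. *)
  pose A := \sum_k `|u ord0 k|; pose L := half_dist s i j + A + 1.
  have box (x : 'rV[R]_n) : (forall k, L * u ord0 k <= x ord0 k <= L * u ord0 k + 1) -> ~ Omega i x.
    move=> hx /(_ _ ji); apply/negP; rewrite -ltNge -/u.
    have -> : x = L *: u + (x - L *: u) by rewrite subrKC.
    rewrite dotvDr dotvZr dotv_unit_dir// mulr1.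
    have : - A <= dotv u (x - L *: u).
      rewrite -lerN2 opprK -dotvNr dotvE; apply: ler_sum => k _.
      apply: le_trans (ler_norm _) _; rewrite normrM ler_piMr//.
      have := hx k; rewrite !mxE => /andP[h1 h2].
      by rewrite normrN ger0_norm ?subr_ge0// lerBlDl.
    rewrite -(lerD2l L); apply: lt_le_trans.
    by rewrite /L addrAC addrK ltrDl.
  by have := lebesgue_rV_neq0 mO box; rewrite O0 eqxx.
exists a, b; split=> //; rewrite lt_eqF// /Pe.
have le_at i : Pe_at s i a * prior i <= Pe_at s i b * prior i.
  by rewrite ler_wpM2r ?hprior.1// ltW.
have [k pk] : exists k, 0 < prior k.
  apply/not_existsP => h; have := hprior.2; rewrite big1.
    by move=> /eqP; rewrite eq_sym oner_eq0.
  move=> k _; apply/eqP; rewrite eq_le hprior.1 andbT leNgt; exact/negP.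
rewrite (bigD1 k)//= [ltRHS](bigD1 k)//= ltr_leD ?ltr_pM2r//.
exact: ler_sum.
Qed.

End noise_convexity.

(** * Inflection points *)

Section inflection.
Context {R : realType}.
Implicit Types (x y z P : R) (Q : R -> Prop).

Lemma at_leftP Q x : (\forall y \near x^'-, Q y) <->
  exists2 d, 0 < d & forall y, x - d < y < x -> Q y.
Proof.
split.
  rewrite near_withinE => /nbhs_ballP[d /= d0 hd]; exists d => // y /andP[xy yx].
  by apply: hd => //; rewrite /ball/= gtr0_norm ?subr_gt0// ltrBlDl -ltrBlDr.
move=> [d d0 hd]; rewrite near_withinE; apply/nbhs_ballP; exists d => //= y.
rewrite /ball/= => xy yx; apply: hd; rewrite yx andbT.
by rewrite gtr0_norm ?subr_gt0// in xy; rewrite ltrBlDr -ltrBlDl.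
Qed.

Lemma at_rightP Q x : (\forall y \near x^'+, Q y) <->
  exists2 d, 0 < d & forall y, x < y < x + d -> Q y.
Proof.
split.
  rewrite near_withinE => /nbhs_ballP[d /= d0 hd]; exists d => // y /andP[xy yx].
  by apply: hd => //; rewrite /ball/= ltr0_norm ?subr_lt0// opprB ltrBlDl.
move=> [d d0 hd]; rewrite near_withinE; apply/nbhs_ballP; exists d => //= y.
rewrite /ball/= => xy yx; apply: hd; rewrite yx/=.
by rewrite ltr0_norm ?subr_lt0// opprB ltrBlDl in xy.
Qed.

Definition isqrt x : R := (Num.sqrt x)^-1.
Definition inv_sqr x : R := (x ^+ 2)^-1.

Lemma isqrt_gt0 x : 0 < x -> 0 < isqrt x.
Proof. by move=> x0; rewrite invr_gt0 sqrtr_gt0. Qed.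

Lemma inv_sqr_gt0 x : 0 < x -> 0 < inv_sqr x.
Proof. by move=> x0; rewrite invr_gt0 exprn_gt0. Qed.

Lemma isqrtK x : 0 < x -> inv_sqr (isqrt x) = x.
Proof. by move=> x0; rewrite /inv_sqr /isqrt exprVn invrK sqr_sqrtr// ltW. Qed.

Lemma inv_sqrK x : 0 < x -> isqrt (inv_sqr x) = x.
Proof. by move=> x0; rewrite /inv_sqr /isqrt sqrtrV ?sqr_ge0// invrK sqrtr_sqr gtr0_norm. Qed.

Lemma ltr_isqrt x y : 0 < x -> 0 < y -> (isqrt x < isqrt y) = (y < x).
Proof.
by move=> x0 y0; rewrite /isqrt ltf_pV2 ?posrE ?sqrtr_gt0// ltr_sqrt.
Qed.

(** The map P -> P^(-1/2) reverses the order, so the left of P corresponds to the right of its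
    image. *)
Lemma near_left_isqrt Q P : 0 < P -> (\forall y \near P^'-, Q (isqrt y)) <->
  exists2 d, 0 < d & forall z, isqrt P < z < isqrt P + d -> Q z.
Proof.
move=> P0; have X0 := isqrt_gt0 P0; split=> [/at_leftP[d d0 hd]|[d d0 hd]].
  pose m := Num.max (P - d) (P / 2).
  have m0 : 0 < m by rewrite lt_max divr_gt0 ?orbT.
  have mP : m < P by rewrite gt_max; apply/andP; split; lra.
  exists (isqrt m - isqrt P); first by rewrite subr_gt0 ltr_isqrt.
  move=> z /andP[Pz]; rewrite subrKC => zm; have z0 := lt_trans X0 Pz.
  rewrite -(inv_sqrK z0) in Pz zm *; have Z0 := inv_sqr_gt0 z0.
  rewrite !ltr_isqrt// in Pz zm; apply: hd; rewrite Pz andbT.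
  by apply: le_lt_trans zm; rewrite le_max lexx.
have X'0 : 0 < isqrt P + d by rewrite addr_gt0.
have Y0 := inv_sqr_gt0 X'0.
apply/at_leftP; exists (P - inv_sqr (isqrt P + d)).
  by rewrite subr_gt0 -ltr_isqrt// inv_sqrK// ltrDl.
move=> y /andP[]; rewrite subKr => h yP; have y0 := lt_trans Y0 h; apply: hd.
by rewrite ltr_isqrt// yP -[ltRHS]inv_sqrK// ltr_isqrt.
Qed.

Lemma near_right_isqrt Q P : 0 < P -> (\forall y \near P^'+, Q (isqrt y)) <->
  exists2 d, 0 < d & forall z, isqrt P - d < z < isqrt P -> Q z.
Proof.
move=> P0; have X0 := isqrt_gt0 P0; split=> [/at_rightP[d d0 hd]|[d d0 hd]].
  have m0 : 0 < P + d by rewrite addr_gt0.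
  have mP : P < P + d by rewrite ltrDl.
  exists (isqrt P - isqrt (P + d)); first by rewrite subr_gt0 ltr_isqrt.
  move=> z /andP[]; rewrite subKr => mz zP; have z0 := lt_trans (isqrt_gt0 m0) mz.
  rewrite -(inv_sqrK z0) in mz zP *; have Z0 := inv_sqr_gt0 z0.
  by rewrite !ltr_isqrt// in mz zP; apply: hd; rewrite mz zP.
pose m := Num.max (isqrt P - d) (isqrt P / 2).
have m0 : 0 < m by rewrite lt_max divr_gt0 ?orbT.
have mP : m < isqrt P by rewrite gt_max; apply/andP; split; lra.
have Y0 := inv_sqr_gt0 m0.
apply/at_rightP; exists (inv_sqr m - P).
  by rewrite subr_gt0 -ltr_isqrt// inv_sqrK.
move=> y /andP[Py]; rewrite subrKC => ym; have y0 := lt_trans P0 Py; apply: hd.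
rewrite ltr_isqrt// Py andbT.
apply: (@le_lt_trans _ _ m); first by rewrite le_max lexx.
by rewrite -[ltLHS]inv_sqrK// ltr_isqrt.
Qed.

Lemma is_derive_isqrt P : 0 < P -> is_derive P 1 isqrt (- (2^-1 * isqrt P ^+ 3)).
Proof.
move=> P0; have s0 : 0 < Num.sqrt P by rewrite sqrtr_gt0.
have := @is_deriveV R Num.sqrt P _ 1 (lt0r_neq0 s0) (is_derive1_sqrt P0).
move=> h; apply: is_derive_eq h _; rewrite /GRing.scale/= /isqrt.
by field; rewrite gt_eqF.
Qed.

(** * Second derivatives in P, for [Pe] and, with the sign e, for [Pc] and [- Pe] *)

Section second_derivative.
Variables (F : nat -> R -> R) (f : R -> R) (c0 : R) (e : bool).
Hypotheses (FE : deriv_seq F) (FB : factorial_bound F).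
Hypothesis fE : forall P, 0 < P -> f P = c0 + (-1) ^+ e * F 0%N (isqrt P).
Local Notation K := (inflection_seq F 0).

Definition deriv_isqrt P : R := (-1) ^+ e * (F 1%N (isqrt P) * - (2^-1 * isqrt P ^+ 3)).
Definition deriv2_isqrt P : R := (-1) ^+ e * (isqrt P ^+ 5 / 4 * K (isqrt P)).

Lemma near_gt0 P : 0 < P -> \forall y \near P, 0 < y.
Proof. exact: lt_nbhsr. Qed.

Lemma is_derive_f P : 0 < P -> is_derive P 1 f (deriv_isqrt P).
Proof.
move=> P0.
have d := is_deriveD_fun (is_derive_cst c0 P 1)
  (is_deriveZ_fun ((-1) ^+ e) (is_derive1_comp (FE 0%N (isqrt P)) (is_derive_isqrt P0))).
rewrite add0r in d; apply: near_eq_is_derive d.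
by near=> y; rewrite fE//; near: y; exact: near_gt0.
Unshelve. all: by end_near. Qed.

Lemma is_derive_deriv_isqrt P : 0 < P -> is_derive P 1 deriv_isqrt (deriv2_isqrt P).
Proof.
move=> P0; have dX := is_derive_isqrt P0.
have d3 := is_deriveM_fun dX (is_deriveM_fun dX dX).
have d1 := is_derive1_comp (FE 1%N (isqrt P)) dX.
have := is_deriveZ_fun ((-1) ^+ e) (is_deriveM_fun d1 (is_deriveZ_fun (- 2^-1) d3)).
rewrite (_ : (fun y => _) = deriv_isqrt); last first.
  by apply/funext => y; rewrite /deriv_isqrt /= -mulNr !exprS expr0 mulr1.
move=> h; apply: is_derive_eq h _; rewrite /deriv2_isqrt /inflection_seq/=.
by field.
Qed.

Lemma derive1_f P : 0 < P -> derive1 f P = deriv_isqrt P.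
Proof. by move=> P0; have h := is_derive_f P0; rewrite derive1E derive_val. Qed.

Lemma is_derive_derive1 P : 0 < P -> is_derive P 1 (derive1 f) (deriv2_isqrt P).
Proof.
move=> P0; apply: near_eq_is_derive (is_derive_deriv_isqrt P0).
by near=> y; rewrite derive1_f//; near: y; exact: near_gt0.
Unshelve. all: by end_near. Qed.

Lemma derive2_f P : 0 < P -> derive1n 2 f P = deriv2_isqrt P.
Proof.
by move=> P0; have h := is_derive_derive1 P0; rewrite /= derive1E derive_val.
Qed.

Lemma signed_deriv2 P b : 0 < P -> signed b (derive1n 2 f P) <-> signed (b (+) e) (K (isqrt P)).
Proof.
move=> P0; rewrite derive2_f// /signed /deriv2_isqrt signr_addb.
have X5 : 0 < isqrt P ^+ 5 / 4 by rewrite divr_gt0// exprn_gt0// isqrt_gt0.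
by rewrite mulrA mulrCA pmulr_rgt0.
Qed.

Lemma near_left_sign P b : 0 < P ->
  (\forall y \near P^'-, signed b (derive1n 2 f y)) <-> right_sign K (isqrt P) (b (+) e).
Proof.
move=> P0; rewrite /right_sign -(near_left_isqrt (fun z => signed (b (+) e) (K z)) P0).
split=> h.
  near=> y; have y0 : 0 < y by near: y; apply: nbhs_left_gt.
  by apply/(signed_deriv2 _ y0); near: y.
near=> y; have y0 : 0 < y by near: y; apply: nbhs_left_gt.
by apply/(signed_deriv2 _ y0); near: y.
Unshelve. all: by end_near. Qed.

Lemma near_right_sign P b : 0 < P ->
  (\forall y \near P^'+, signed b (derive1n 2 f y)) <-> left_sign K (isqrt P) (b (+) e).
Proof.
move=> P0; rewrite /left_sign -(near_right_isqrt (fun z => signed (b (+) e) (K z)) P0).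
split=> h.
  near=> y; have y0 : 0 < y by apply: lt_trans P0 _; near: y; exact: nbhs_right_gt.
  by apply/(signed_deriv2 _ y0); near: y.
near=> y; have y0 : 0 < y by apply: lt_trans P0 _; near: y; exact: nbhs_right_gt.
by apply/(signed_deriv2 _ y0); near: y.
Unshelve. all: by end_near. Qed.

(** By continuity a nonzero value would impose its sign on both sides. *)
Lemma sign_change_eq0 x : sign_change K x -> K x = 0.
Proof.
move=> [b lb rb]; apply/eqP; apply: contraT => /neq0_signed[c sc].
have KE := inflection_deriv_seq FE.
have rc : right_sign K x c by apply: (@deriv_seq_right_sign _ _ 0%N).
have lc : left_sign K x c by apply: (@deriv_seq_left_sign _ _ 0%N) => //; rewrite addbF.
have := right_sign_inj rb rc; rewrite (left_sign_inj lb lc).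
by case: (c).
Qed.

Lemma changes_sign_signed g P : changes_sign_at g P <->
  exists b, (\forall y \near P^'-, signed b (g y)) /\ (\forall y \near P^'+, signed (~~ b) (g y)).
Proof.
have sT v : signed true v <-> v < 0 by rewrite /signed expr1 mulN1r oppr_gt0.
have sF v : signed false v <-> 0 < v by rewrite /signed expr0 mul1r.
split=> [[[h1 h2]|[h1 h2]]|[[] [h1 h2]]].
- exists true; split; near=> y; [apply/sT|apply/sF]; near: y; [exact: h1|exact: h2].
- exists false; split; near=> y; [apply/sF|apply/sT]; near: y; [exact: h1|exact: h2].
- left; split; near=> y; [apply/sT|apply/sF]; near: y; [exact: h1|exact: h2].
- right; split; near=> y; [apply/sF|apply/sT]; near: y; [exact: h1|exact: h2].
Unshelve. all: by end_near. Qed.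

Lemma inflection_pointE P : 0 < P -> inflection_point f P <-> sign_change K (isqrt P).
Proof.
move=> P0; split=> [[_ _ /changes_sign_signed[b [lb rb]]]|sc].
  (* The sides are exchanged by [isqrt], hence the negation; e accounts for the sign in front of
     F. *)
  exists (~~ b (+) e); first exact/near_right_sign.
  by rewrite -addNb negbK; exact/near_left_sign.
split.
- near=> y; have y0 : 0 < y by near: y; exact: near_gt0.
  have := is_derive_f y0; have := is_derive_derive1 y0 => h1 h2.
  by split; exact: ex_derive.
- by rewrite derive2_f// /deriv2_isqrt sign_change_eq0// !mulr0.
- apply/changes_sign_signed; case: sc => b lb rb; exists (~~ b (+) e); split.
    by apply/near_left_sign => //; rewrite -addbA addbb addbF.
  by apply/near_right_sign => //; rewrite -addNb negbK -addbA addbb addbF.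
Unshelve. all: by end_near. Qed.

Lemma midpoint_signed a b : 0 < a -> a < b ->
  (forall P, a < P < b -> signed (~~ e) (K (isqrt P))) -> f a + f b < 2 * f ((a + b) / 2).
Proof.
move=> a0 ab hK.
have pos x : a <= x <= b -> 0 < x by move=> /andP[ax _]; exact: lt_le_trans ax.
apply: (@derive2_lt0_midpoint _ f deriv_isqrt deriv2_isqrt a b ab) => x xab.
- exact: is_derive_f (pos _ xab).
- exact: is_derive_deriv_isqrt (pos _ xab).
- have x0 : 0 < x by move: xab => /andP[ax _]; exact: lt_trans ax.
  have : signed true (derive1n 2 f x) by apply/(signed_deriv2 _ x0); exact: hK.
  by rewrite derive2_f// /signed expr1 mulN1r oppr_gt0.
Qed.

End second_derivative.

Lemma card_eq_seq (D : set R) (r : seq R) : uniq r ->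
  (forall x, D x <-> x \in r) -> (D #= `I_(size r))%card.
Proof.
elim: r D => [|a r IH] D /=.
  move=> _ Dr; rewrite (_ : D = set0) ?II0//.
  by apply/seteqP; split=> // x /Dr.
move=> /andP[ar ur] Dr; apply/eq_cardSP; exists a; first by apply/Dr; rewrite inE eqxx.
apply: IH => // x; split=> [[/Dr]|xr]; first by rewrite inE => /predU1P[-> []|].
split; first by apply/Dr; rewrite inE xr orbT.
by move=> /= xa; move: ar; rewrite -xa xr.
Qed.

End inflection.

(** * Counting the sign changes of 3 f' + x f'' *)

Section inflection_points.
Context {R : realType} {n M : nat}.
Variables (s : 'I_M -> 'rV[R]_n) (prior : 'I_M -> R).
Hypotheses (hn : (1 <= n)%N) (hM : (2 <= M)%N) (hs : injective s).
Hypothesis hprior : is_prior prior.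
Variable F : nat -> R -> R.
Hypotheses (FE : deriv_seq F) (FB : factorial_bound F).
Hypothesis PeF : forall P, 0 < P -> Pe s prior P = F 0%N (isqrt P).
Local Notation Omega := (decision_region s).
Local Notation K := (inflection_seq F 0).
Local Notation mid := [set P : R | 0 < P /\
  (low_noise_bound s <= P%:E <= high_noise_bound s)%E].

Lemma decision_region_star i x t : 0 <= t <= 1 -> Omega i x -> Omega i (t *: x).
Proof.
move=> /andP[t0 t1] Ox j ji; rewrite dotvZr.
have b0 := ltW (half_dist_gt0 hs ji).
apply: le_trans (_ : t * half_dist s i j <= _); first by rewrite ler_wpM2l// Ox.
by rewrite ler_piMl.
Qed.

(** In the rescaled integral a larger P moves points away from the origin, and a region star-shaped
    about the origin can only lose points. *)
Lemma Pc_at_nonincreasing i (P Q : R) : 0 < P -> P <= Q -> Pc_at s i Q <= Pc_at s i P.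
Proof.
move=> P0 PQ; have Q0 := lt_le_trans P0 PQ.
rewrite (Pc_at_scale _ _ Q0) (Pc_at_scale _ _ P0).
have int (r : R) : (lebesgue_rV n).-integrable setT
    (EFin \o (fun x => \1_(Omega i) (r *: x) * gauss_density 1 x)).
  have := @integrable_gauss_indic R n _ 1 r 0 (measurable_decision_region s i).
  by congr integrable; apply/funext => x /=; rewrite mul1r subr0.
apply: le_Rintegral => // x _; rewrite ler_wpM2r ?gauss_density_ge0// !indicE.
have sQ : 0 < Num.sqrt Q by rewrite sqrtr_gt0.
have [|_] := boolP (_ \in Omega i); last by rewrite ler0n.
rewrite inE => OQ; rewrite mem_set//.
have -> : Num.sqrt P *: x = (Num.sqrt P / Num.sqrt Q) *: (Num.sqrt Q *: x).
  by rewrite scalerA divfK// gt_eqF.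
apply: decision_region_star OQ; rewrite divr_ge0 ?sqrtr_ge0//=.
by rewrite ler_pdivrMr// mul1r ler_wsqrtr.
Qed.

Lemma F0_nonincreasing x y : 0 < x -> x <= y -> F 0%N y <= F 0%N x.
Proof.
move=> x0 xy; have y0 := lt_le_trans x0 xy.
have X0 := inv_sqr_gt0 x0; have Y0 := inv_sqr_gt0 y0.
rewrite -(inv_sqrK x0) -(inv_sqrK y0) -(PeF X0) -(PeF Y0).
apply: ler_sum => i _; rewrite ler_wpM2r ?hprior.1// lerD2l lerN2.
apply: Pc_at_nonincreasing => //.
rewrite /inv_sqr lef_pV2 ?posrE ?exprn_gt0//.
by rewrite lerXn2r// nnegrE ltW.
Qed.

(* At the first nonvanishing derivative of f = F 0 at 0, of order m + 1,
   the m-th derivative of 3 f' + x f'' is (3 + m) times as large. *)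
Lemma inflection_right_sign0 : right_sign K 0 true.
Proof.
have GE := deriv_seq_shift FE.
have [F1z|] := pselect (forall x, F 1%N x = 0).
  have [a [b [a0 b0 /eqP[]]]] := Pe_not_constant hM hs hprior.
  rewrite !PeF//; apply: is_derive_0_is_cst => x.
  by apply: is_derive_eq (FE 0%N x) _.
move=> /existsNP[y /eqP Fy].
have [|m [Fm Fj]] := @first_nonzero _ (fun k => F k.+1) 0.
  move=> h; suff : F 1%N y = 0 by move/eqP; rewrite (negbTE Fy).
  apply: (@entire_zero _ (fun k => F k.+1) 0 GE _ h) => B.
  have [C [L [C0 L0 hF]]] := FB B; exists (C * L), (2 * L).
  split; rewrite ?mulr_ge0// => k x xB.
  apply: le_trans (hF _ _ xB) _; rewrite factS natrM exprS exprMn.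
  have -> : C * (L * L ^+ k) * (k.+1%:R * k`!%:R) = C * L * L ^+ k * k`!%:R * k.+1%:R by ring.
  have -> : C * L * (2 ^+ k * L ^+ k) * k`!%:R = C * L * L ^+ k * k`!%:R * 2 ^+ k by ring.
  rewrite ler_wpM2l ?mulr_ge0 ?exprn_ge0//.
  by rewrite -natrX ler_nat ltn_expl.
have [b sb] := neq0_signed Fm.
have [d d0 hd] := deriv_seq_right_sign GE Fj sb; rewrite add0r in hd.
have bT : b = true.
  (* F 1 has the constant sign b on ]0, d[, while F 0 nonincreasing forces F 1 <= 0 at a mean value
     point. *)
  have [p q] : 0 < d / 4 /\ d / 4 < d / 2 by split; lra.
  have [c /andP[pc cq] e] := mean_value q (fun z _ => FE 0%N z).
  have c0 : 0 < c by exact: lt_trans pc.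
  have : F 1%N c <= 0.
    rewrite -(@pmulr_lle0 _ (d / 2 - d / 4)) ?subr_gt0// -e subr_le0.
    by apply: F0_nonincreasing => //; exact: ltW.
  have := hd c; rewrite c0 (_ : c < d)/=; last by lra.
  move=> /(_ isT); case: (b) => //; rewrite /signed expr0 mul1r => h.
  by rewrite leNgt h.
rewrite bT in sb.
apply: (deriv_seq_right_sign (m := m) (inflection_deriv_seq FE)).
  by move=> j jm; rewrite /inflection_seq mul0r Fj// mulr0 addr0.
by rewrite /inflection_seq mul0r addr0 /signed mulrCA pmulr_rgt0// ltr0n.
Qed.

Lemma K_neq0 : exists x, K x != 0.
Proof.
have [d d0 hd] := inflection_right_sign0; exists (d / 2).
apply/eqP => K0; have := hd (d / 2).
rewrite K0 /signed mulr0 ltxx add0r divr_gt0//= => h.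
have d2 : d / 2 < d by lra.
by have := h d2.
Qed.

Lemma K_right_sign x : exists b, right_sign K x b.
Proof.
apply: (entire_right_sign _ (inflection_deriv_seq FE) (inflection_factorial_bound FB)).
exact: K_neq0.
Qed.

Lemma K_left_sign x : exists b, left_sign K x b.
Proof.
apply: (entire_left_sign _ (inflection_deriv_seq FE) (inflection_factorial_bound FB)).
exact: K_neq0.
Qed.

(** Negativity would put the midpoint value of [Pe] strictly above the average of the end values,
    against convexity. *)
Lemma not_negative_low a b : 0 < a -> a < b -> (b%:E <= low_noise_bound s)%E ->
  ~ forall P, a < P < b -> signed true (K (isqrt P)).
Proof.
move=> a0 ab bl hK.
have PeF' P : 0 < P -> Pe s prior P = 0 + (-1) ^+ false * F 0%N (isqrt P).
  by move=> P0; rewrite add0r expr0 mul1r PeF.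
have := midpoint_signed FE PeF' a0 ab hK.
have h01 : 0 < (2^-1 : R) < 1 by rewrite invr_gt0 ltr0n invf_lt1 ?ltr1n.
have := Pe_convex_low hM hs hprior a0 bl ab h01.
rewrite (_ : 2^-1 * a + (1 - 2^-1) * b = (a + b) / 2); last by field.
move: (Pe _ _ _) (Pe _ _ _) (Pe _ _ _) => u v w; lra.
Qed.

Lemma not_positive_high a b : 0 < a -> a < b -> (high_noise_bound s <= a%:E)%E ->
  ~ forall P, a < P < b -> signed false (K (isqrt P)).
Proof.
move=> a0 ab ha hK.
have PeF' P : 0 < P -> - Pe s prior P = 0 + (-1) ^+ true * F 0%N (isqrt P).
  by move=> P0; rewrite add0r expr1 mulN1r PeF.
have := @midpoint_signed _ _ (fun P => - Pe s prior P) _ true FE PeF' a b a0 ab hK.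
have h01 : 0 < (2^-1 : R) < 1 by rewrite invr_gt0 ltr0n invf_lt1 ?ltr1n.
have := Pe_concave_high hn hs hprior a0 ha ab h01.
rewrite (_ : 2^-1 * a + (1 - 2^-1) * b = (a + b) / 2); last by field.
move: (Pe _ _ _) (Pe _ _ _) (Pe _ _ _) => u v w; lra.
Qed.

Lemma left_sign_interval P v c : 0 < P -> P < v -> left_sign K (isqrt P) c ->
  exists b, [/\ P < b, b <= v & forall y, P < y < b -> signed c (K (isqrt y))].
Proof.
move=> P0 Pv /(near_right_isqrt (fun z => signed c (K z)) P0)/at_rightP[d d0 hd].
exists (Num.min (P + d) v); split.
- by rewrite lt_min Pv ltrDl d0.
- by rewrite ge_min lexx orbT.
- by move=> y /andP[Py]; rewrite lt_min => /andP[yd _]; apply: hd; rewrite Py.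
Qed.

Lemma right_sign_interval P u c : 0 < P -> u < P -> right_sign K (isqrt P) c ->
  exists a, [/\ u <= a, a < P & forall y, a < y < P -> signed c (K (isqrt y))].
Proof.
move=> P0 uP /(near_left_isqrt (fun z => signed c (K z)) P0)/at_leftP[d d0 hd].
exists (Num.max (P - d) u); split.
- by rewrite le_max lexx orbT.
- by rewrite gt_max uP andbT gtrBl.
- by move=> y /andP[]; rewrite gt_max => /andP[yd _] yP; apply: hd; rewrite yd.
Qed.

(** Both signs occur next to a sign change, one on each side, so any prescribed sign c is realized
    on an interval. Below and above the thresholds, c is the forbidden sign. *)
Lemma sign_change_interval P u v c : 0 < P -> u < P -> P < v -> sign_change K (isqrt P) ->
  exists a b, [/\ u <= a, a < b, b <= v & forall y, a < y < b -> signed c (K (isqrt y))].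
Proof.
move=> P0 uP Pv [b lb rb]; have [bc|bc] := eqVneq b c.
  rewrite bc in lb; have [b' [h1 h2 h3]] := left_sign_interval P0 Pv lb.
  by exists P, b'; split=> //; exact: ltW.
have {}rb : right_sign K (isqrt P) c by move: bc rb; case: (b); case: (c).
have [a [h1 h2 h3]] := right_sign_interval P0 uP rb.
by exists a, P; split=> //; exact: ltW.
Qed.

Lemma sign_change_low P : 0 < P -> sign_change K (isqrt P) ->
  (low_noise_bound s <= P%:E)%E.
Proof.
move=> P0 sc; have [L L0 LE] := low_noise_bound_gt0 hM hs.
rewrite leNgt; apply/negP; rewrite LE lte_fin => PL.
have P2 : P / 2 < P by lra.
have [a [b [ua ab bL hK]]] := sign_change_interval true P0 P2 PL sc.
apply: (not_negative_low _ ab _ hK); first by apply: lt_le_trans ua; rewrite divr_gt0.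
by rewrite LE lee_fin.
Qed.

Lemma sign_change_high P : 0 < P -> sign_change K (isqrt P) ->
  (P%:E <= high_noise_bound s)%E.
Proof.
move=> P0 sc; rewrite leNgt; apply/negP => HP.
(* Room to the left of P, since the interval of forbidden sign may lie on either side. Comparison
   with P / 2 keeps u positive whatever the bound. *)
have [u [u0 uP hu]] : exists u : R, [/\ 0 < u, u < P & (high_noise_bound s <= u%:E)%E].
  move: HP; case: (high_noise_bound s) => [H|//|].
    rewrite lte_fin => HP; exists (Num.max H (P / 2)); split.
    - by rewrite lt_max divr_gt0 ?orbT.
    - by rewrite gt_max HP/=; lra.
    - by rewrite lee_fin le_max lexx.
  move=> _; exists (P / 2); split; [by rewrite divr_gt0|lra|exact: leNye].
have P1 : P < P + 1 by rewrite ltrDl.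
have [a [b [ua ab bL hK]]] := sign_change_interval false P0 uP P1 sc.
apply: (not_positive_high _ ab _ hK); first exact: lt_le_trans ua.
by apply: le_trans hu _; rewrite lee_fin.
Qed.

Lemma odd_sign_changes : exists r : seq R,
  [/\ uniq r, odd (size r) & forall z, (z \in r) <-> (0 < z /\ sign_change K z)].
Proof.
have [L L0 LE] := low_noise_bound_gt0 hM hs.
(* Sign changes occur only at noise powers P >= L, so all of them lie strictly left of x =
   [isqrt (L / 2)], as counting by [parity] requires. *)
have L20 : 0 < L / 2 by rewrite divr_gt0.
have L2L : L / 2 < L by lra.
have E0 := isqrt_gt0 L20.
have [b lb] := K_left_sign (isqrt (L / 2)).
(* The sign left of [isqrt (L / 2)] is that at noise powers just above L / 2, still below L, where
   negativity is excluded. With the negative sign at 0, this makes the count odd. *)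
have bF : b = false.
  case: b lb => // lb; have [b' [h1 h2 h3]] := left_sign_interval L20 L2L lb.
  by have := not_negative_low L20 h1; rewrite LE lee_fin => /(_ h2)/(_ h3).
rewrite bF in lb.
have [r [ur rE /= or]] := parity_gt0 (fun x _ => K_right_sign x) (fun x _ => K_left_sign x)
  inflection_right_sign0 E0 lb.
exists r; split=> // z; split=> [/rE[/andP[z0 _]]//|[z0 sz]].
apply/rE; split=> //; rewrite z0/= -(inv_sqrK z0).
have Z0 := inv_sqr_gt0 z0; rewrite ltr_isqrt//; apply: lt_le_trans L2L _.
have := @sign_change_low _ Z0; rewrite inv_sqrK// => /(_ sz).
by rewrite LE lee_fin.
Qed.

(** The injection [inv_sqr] carries the sign changes to inflection points, and the two bounds on
    sign changes place all of them in the range. *)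
Lemma odd_inflection_points f c0 (e : bool) :
  (forall P, 0 < P -> f P = c0 + (-1) ^+ e * F 0%N (isqrt P)) ->
  odd_cardinal (mid `&` [set P | inflection_point f P]).
Proof.
move=> fE; have [r [ur or rE]] := odd_sign_changes.
have r0 z : z \in r -> 0 < z by move=> /rE[].
exists (size (map inv_sqr r)); first by rewrite size_map.
apply: card_eq_seq.
  rewrite map_inj_in_uniq// => x y /r0 x0 /r0 y0 xy.
  by rewrite -(inv_sqrK x0) xy inv_sqrK.
move=> P; split=> [[/= [P0 _]]|/mapP[z zr ->]].
  move=> /(inflection_pointE FE fE P0) sc; apply/mapP; exists (isqrt P).
    by apply/rE; split=> //; exact: isqrt_gt0.
  by rewrite isqrtK.
have z0 := r0 _ zr; have Z0 := inv_sqr_gt0 z0; have [_ sz] := (rE z).1 zr.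
have sc : sign_change K (isqrt (inv_sqr z)) by rewrite inv_sqrK.
split; first by split=> //; rewrite sign_change_low// sign_change_high.
exact/(inflection_pointE FE fE Z0).
Qed.

End inflection_points.

Theorem corollary5p1 (R : realType) (n M : nat)
    (s : 'I_M -> 'rV[R]_n) (prior : 'I_M -> R)
    (hn : (1 <= n)%N) (hM : (2 <= M)%N)
    (hs : injective s) (hnorm : normalized s) (hprior : is_prior prior) :
  let high := [set P : R | 0 < P /\ (high_noise_bound s <= P%:E)%E] in
  let low := [set P : R | 0 < P /\ (P%:E <= low_noise_bound s)%E] in
  let mid := [set P : R | 0 < P /\
    (low_noise_bound s <= P%:E <= high_noise_bound s)%E] in
  [/\ concave_on high (Pe s prior) /\ convex_on high (Pc s prior),
      convex_on low (Pe s prior) /\ concave_on low (Pc s prior)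
    & odd_cardinal (mid `&` [set P | inflection_point (Pe s prior) P]) /\
      odd_cardinal (mid `&` [set P | inflection_point (Pc s prior) P])].
Proof.
move=> high low mid.
have [F [FE FB PeF]] := Pe_entire s prior.
split; split.
- apply: convex_onP => a b t [a0 ha] _ ab t01.
  have := Pe_concave_high hn hs hprior a0 ha ab t01.
  by move: (Pe _ _ _) (Pe _ _ _) (Pe _ _ _) => u v w; lra.
- apply: convex_onP => a b t [a0 ha] _ ab t01; rewrite /Pc.
  have := Pe_concave_high hn hs hprior a0 ha ab t01.
  by move: (Pe _ _ _) (Pe _ _ _) (Pe _ _ _) => u v w; lra.
- apply: convex_onP => a b t [a0 _] [_ bl] ab t01.
  exact: Pe_convex_low.
- apply: convex_onP => a b t [a0 _] [_ bl] ab t01; rewrite /Pc.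
  have := Pe_convex_low hM hs hprior a0 bl ab t01.
  by move: (Pe _ _ _) (Pe _ _ _) (Pe _ _ _) => u v w; lra.
- apply: (odd_inflection_points hn hM hs hprior FE FB PeF (c0 := 0) (e := false)).
  by move=> P P0; rewrite add0r expr0 mul1r PeF.
- apply: (odd_inflection_points hn hM hs hprior FE FB PeF (c0 := 1) (e := true)).
  by move=> P P0; rewrite expr1 mulN1r /Pc PeF.
Qed.
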